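(* The following two identities hold: $$\int_0^1\frac{\log\left(\frac1y\right)\log\left(\log\left(\frac1y\right)\right)\log(1+y)}{1+y}\,dy=\frac18(1-\gamma)\zeta(3)-\frac12\sum_{n=1}^{\infty}\sum_{m=1}^{\infty}\frac{(-1)^{m+n}\log(m+n)}{mn(n+m)},$$ and $$\int_0^1\frac{\log\left(\frac1y\right)\log\left(\log\left(\frac1y\right)\right)\tan^{-1}(y)}{1+y^2}\,dy=\frac{1-\gamma}{16}\left(4\pi G-7\zeta(3)\right)-\frac12\sum_{n=0}^{\infty}\sum_{m=0}^{\infty}\frac{(-1)^{m+n}\log(2m+2n+2)}{(2m+1)(2n+1)(2m+2n+2)},$$ where $\gamma$ is Euler's constant and $G$ is Catalan's constant.
   Context: $\zeta$ is the Riemann zeta function; $G=\sum_{n\ge0}\frac{(-1)^n}{(2n+1)^2}$. *)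

(* Defs.v *)
From Stdlib Require Import Reals.
From Coquelicot Require Import Coquelicot.
Open Scope R_scope.

(* Given by its Dirichlet series, hence meaningful only for real s > 1. *)
Definition zeta (s : R) : R := Series (fun n => / Rpower (INR (S n)) s).

(* The limit of H_(n+1) - ln (n+1). *)
Definition euler_gamma : R :=
  real (Lim_seq (fun n => sum_n (fun k => / INR (S k)) n - ln (INR (S n)))).

Definition catalan : R := Series (fun n => (-1) ^ n / (2 * INR n + 1) ^ 2).

(* [Series] also has a (meaningless) value on divergent series: this says
   that the iterated sum over n (outer) and m (inner) of [a n m] converges. *)
Definition ex_iterated_series (a : nat -> nat -> R) : Prop :=
  (forall n, ex_series (a n)) /\ ex_series (fun n => Series (a n)).

Definition iterated_series (a : nat -> nat -> R) : R :=
  Series (fun n => Series (a n)).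

(* For n, m >= 1; sums starting at 1 are obtained by substituting S n, S m. *)
Definition log_term (n m : nat) : R :=
  (-1) ^ (m + n) * ln (INR (m + n)) / (INR m * INR n * INR (n + m)).

Definition atan_term (n m : nat) : R :=
  (-1) ^ (m + n) * ln (INR (2 * m + 2 * n + 2)) /
  (INR (2 * m + 1) * INR (2 * n + 1) * INR (2 * m + 2 * n + 2)).

(* Main.v *)
(* Write [w y = ln (1/y) ln ln (1/y)]. Its moments are
   [int_0^1 y^(k-1) w = (1 - gamma - ln k) / k^2] for [k >= 2]: an explicit primitive reduces them to
   Gauss's integral [int_0^1 (1/(1-u) + 1/ln u) du = gamma], the substitution [u = y^k] producing
   the [ln k]. Expanding [ln^2 (1+y)] and [atan^2 y] as double power series [sum a_(m,n) y^k],
   differentiating and integrating against [w] term by term turns both integrals into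
   [1/2 sum a_(m,n) (1 - gamma - ln k) / k]. The interchange is elementary, because the partial sums
   of the alternating expansions have remainder at most [y^N] on (0,1). What is left is
   [sum a_(m,n) / k], that is [int_0^1 ln^2 (1+y) / y dy = zeta 3 / 4] and
   [int_0^1 atan^2 y / y dy = (PI/2) G - (7/8) zeta 3]; the latter comes from [y = tan (x/2)] and the
   finite expansion [(1 - cos (2N x)) / sin x = 2 sum_(k<N) sin ((2k+1) x)]. *)
Require Import Defs.
From Stdlib Require Import Reals Lra Lia.
From Coquelicot Require Import Coquelicot.
Open Scope R_scope.

(** Integrals are proper Riemann integrals, while the weight is unbounded at [0]. The basic
    integrand is therefore [y * weight y], continuous on the whole line, and the missing factor is
    borrowed from [L y = y * (L y / y)], where [L] is [ln (1 + y)] or [atan]; this is why the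
    moments start at [k = 2]. Both identities are one statement about a primitive [L] of
    [1 / (1 + y ^ p)] with [L 0 = 0], taken at [p = 1] and [p = 2]. The default values of [ln] and
    of the inverse shape the continuity arguments. They often agree with a limit, but [L y / y] gets
    the value [0] at [0] instead of its limit [1]; so continuity is asked only of its products with
    functions vanishing at [0]. In the interchange the bound [y ^ N] does not tend to [0] uniformly
    up to [y = 1]; its integral [1 / (N + 1)] does, and one summation index is treated at a time. *)

(** * Continuity *)

(* Coquelicot states equalities in its own structures, where [ring] and [field] do not
   recognise the type as [R]. *)
Ltac real_eq := match goal with |- @eq _ ?a ?b => change (@eq R a b) end.

(** The primitives used below contain logarithms that are singular at [0] or [1], so
    differentiability is asked only inside the interval and continuity at its ends. Extending [f]
    continuously to the line makes its integral a primitive everywhere; the mean value theorem then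
    shows that it differs from [F] by a constant. *)
Lemma is_RInt_antiderivative (f F : R -> R) (a b : R) : a < b ->
  (forall x, a <= x <= b -> continuous f x) ->
  (forall x, a <= x <= b -> continuous F x) ->
  (forall x, a < x < b -> is_derive F x (f x)) ->
  is_RInt f a b (F b - F a).
Proof.
intros Hab Hf HF HD.
destruct (C0_extension_le f a b Hf) as [g [Hg Hfg]].
assert (Hex : forall x, ex_RInt g a x).
{ intros x. apply (ex_RInt_continuous (V := R_CompleteNormedModule)).
  intros z _. apply Hg. }
assert (HG : forall x, is_derive (fun x => RInt g a x) x (g x)).
{ intros x. apply (is_derive_RInt g _ a).
  - apply filter_forall. intros y. apply (RInt_correct g a y (Hex y)).
  - apply Hg. }
destruct (MVT_gen (fun x => F x - RInt g a x) a b (fun _ => 0)) as [c [_ Hc]].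
- intros x Hx. rewrite Rmin_left, Rmax_right in Hx by lra.
  replace 0 with (minus (f x) (g x)).
  + apply (is_derive_minus F (fun x => RInt g a x)); [apply HD; lra | apply HG].
  + rewrite Hfg by lra. unfold minus, plus, opp; simpl; ring.
- intros x Hx. rewrite Rmin_left, Rmax_right in Hx by lra.
  apply continuity_pt_filterlim.
  apply (continuous_minus F (fun x => RInt g a x)).
  + apply HF; lra.
  + apply (ex_derive_continuous (V := R_NormedModule)). eexists; apply HG.
- rewrite RInt_point in Hc.
  replace (F b - F a) with (RInt g a b) by (unfold zero in Hc; simpl in Hc; lra).
  apply is_RInt_ext with g.
  + intros x Hx. rewrite Rmin_left, Rmax_right in Hx by lra. apply Hfg; lra.
  + apply (RInt_correct g a b (Hex b)).
Qed.

Lemma ln_le_sub_1 (x : R) : 0 < x -> ln x <= x - 1.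
Proof.
intros Hx. pose proof (exp_ineq1_le (ln x)) as H. rewrite exp_ln in H by lra. lra.
Qed.

Lemma ln_nonpos (x : R) : x <= 0 -> ln x = 0.
Proof.
intros Hx. unfold ln. destruct (Rlt_dec 0 x); [exfalso; lra | reflexivity].
Qed.

Lemma continuous_dominated (f g : R -> R) (x : R) :
  continuous g x -> g x = 0 -> locally x (fun y => Rabs (f y) <= g y) ->
  continuous f x.
Proof.
intros Hg Hg0 Hle. apply filterlim_locally. intros eps.
assert (Hfx : f x = 0).
{ apply locally_singleton in Hle. rewrite Hg0 in Hle.
  pose proof (Rabs_pos (f x)). destruct (Req_dec (f x) 0) as [H0|H0]; [exact H0|].
  apply Rabs_pos_lt in H0. lra. }
pose proof (proj1 (filterlim_locally g (g x)) Hg eps) as Hb.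
generalize (filter_and _ _ Hle Hb). apply filter_imp. intros y [H1 H2].
change (Rabs (g y - g x) < eps) in H2. change (Rabs (f y - f x) < eps).
rewrite Hg0, Rminus_0_r in H2. rewrite Hfx, Rminus_0_r.
pose proof (Rle_abs (g y)). lra.
Qed.

Lemma locally_gt (a x : R) : a < x -> locally x (fun y => a < y).
Proof. intros H. exact (open_gt a x H). Qed.

Lemma locally_lt (a x : R) : x < a -> locally x (fun y => y < a).
Proof. intros H. exact (open_lt a x H). Qed.

Lemma continuous_of_derive (f : R -> R) (x : R) : ex_derive f x -> continuous f x.
Proof. exact (ex_derive_continuous f x). Qed.

Lemma continuous_Rabs (x : R) : continuous Rabs x.
Proof. apply continuity_pt_filterlim. apply Rcontinuity_abs. Qed.

Lemma continuous_eq_locally (f g : R -> R) (x : R) :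
  locally x (fun y => f y = g y) -> continuous g x -> continuous f x.
Proof.
intros H. apply continuous_ext_loc. revert H. apply filter_imp. intros y Hy.
symmetry. exact Hy.
Qed.

(** Near [0], writing [ln y = - 2 ln (1 / s)] with [s = sqrt y] and using [ln u <= u - 1] at
    [u = 1 / s] bounds the function by [2 s]. To the left of [0] the default value of [ln] makes it
    vanish. *)
Lemma continuous_x_ln_x (x : R) : continuous (fun x => x * ln x) x.
Proof.
destruct (Rtotal_order x 0) as [Hx|[Hx|Hx]].
- apply continuous_eq_locally with (fun _ => 0).
  + generalize (locally_lt 0 x Hx). apply filter_imp. intros y Hy.
    rewrite ln_nonpos by lra. ring.
  + apply continuous_const.
- subst x. apply continuous_dominated with (fun y => 2 * sqrt (Rabs y)).
  + apply (continuous_mult (fun _ => 2) (fun y => sqrt (Rabs y))).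
    * apply continuous_const.
    * apply continuous_sqrt_comp. apply continuous_Rabs.
  + rewrite Rabs_R0, sqrt_0. ring.
  + generalize (locally_lt 1 0 Rlt_0_1). apply filter_imp. intros y Hy.
    destruct (Rle_or_lt y 0) as [Hy0|Hy0].
    { rewrite ln_nonpos, Rmult_0_r, Rabs_R0 by lra.
      pose proof (sqrt_pos (Rabs y)). lra. }
    rewrite (Rabs_pos_eq y) by lra.
    pose proof (sqrt_lt_R0 y Hy0) as Hs. pose proof (sqrt_sqrt y (Rlt_le _ _ Hy0)) as Hss.
    set (s := sqrt y) in *.
    assert (Hl : ln y <= 0) by (rewrite <- ln_1; apply ln_le; lra).
    rewrite Rabs_mult, (Rabs_pos_eq y), (Rabs_left1 (ln y)) by lra.
    assert (H1 : ln y = - (2 * ln (/ s))).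
    { rewrite <- Hss, ln_mult, ln_Rinv by lra. ring. }
    rewrite H1. pose proof (ln_le_sub_1 (/ s) (Rinv_0_lt_compat _ Hs)) as H2.
    apply Rle_trans with (y * (2 * / s)).
    { apply Rmult_le_compat_l; lra. }
    rewrite <- Hss. right. field. lra.
- apply continuous_of_derive. auto_derive. exact Hx.
Qed.

(** For [0 < y < exp (-1)] one has [ln (1 / y) > 1], hence [0 <= ln (ln (1 / y)) <= ln (1 / y)], and
    the function is dominated by [y * ln y]. *)
Lemma continuous_x_lnln (x : R) : x < 1 ->
  continuous (fun y => y * ln (ln (1 / y))) x.
Proof.
intros Hx1. destruct (Rtotal_order x 0) as [Hx|[Hx|Hx]].
- apply continuous_eq_locally with (fun _ => 0).
  + generalize (locally_lt 0 x Hx). apply filter_imp. intros y Hy.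
    pose proof (Rinv_lt_0_compat y Hy).
    rewrite (ln_nonpos (1 / y)), ln_nonpos by lra. ring.
  + apply continuous_const.
- subst x. apply continuous_dominated with (fun y => Rabs (y * ln y)).
  + apply (continuous_comp (fun y => y * ln y) Rabs);
      [apply continuous_x_ln_x | apply continuous_Rabs].
  + rewrite Rmult_0_l, Rabs_R0. reflexivity.
  + generalize (locally_lt (exp (-1)) 0 (exp_pos _)). apply filter_imp. intros y Hy.
    rewrite !Rabs_mult. apply Rmult_le_compat_l; [apply Rabs_pos|].
    destruct (Rle_or_lt y 0) as [Hy0|Hy0].
    { assert (1 / y <= 0).
      { destruct Hy0 as [Hy0|Hy0].
        - pose proof (Rinv_lt_0_compat y Hy0). lra.
        - rewrite Hy0. unfold Rdiv. rewrite Rinv_0. lra. }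
      rewrite (ln_nonpos (1 / y)), (ln_nonpos 0) by lra. rewrite Rabs_R0. apply Rabs_pos. }
    assert (Hl : ln y < -1).
    { rewrite <- (ln_exp (-1)). apply ln_increasing; lra. }
    unfold Rdiv. rewrite Rmult_1_l, ln_Rinv by lra.
    rewrite (Rabs_left1 (ln y)) by lra.
    pose proof (ln_le_sub_1 (- ln y)). pose proof (ln_le 1 (- ln y)). rewrite ln_1 in *.
    rewrite Rabs_pos_eq by lra. lra.
- apply continuous_of_derive. auto_derive.
  assert (0 < ln (1 / x)).
  { unfold Rdiv. rewrite Rmult_1_l, ln_Rinv by lra.
    pose proof (ln_le_sub_1 x Hx). lra. }
  assert (0 < 1 / x) by (apply Rdiv_lt_0_compat; lra).
  unfold Rdiv in *. rewrite Rmult_1_l in *. repeat split; lra.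
Qed.

Lemma Rabs_x_ln_x_le (t : R) : 0 <= t -> Rabs (t * ln t) <= t ^ 2 + 1.
Proof.
intros [Ht|Ht].
- pose proof (ln_le_sub_1 t Ht) as H1.
  pose proof (ln_le_sub_1 (/ t) (Rinv_0_lt_compat _ Ht)) as H2.
  rewrite ln_Rinv in H2 by lra.
  apply Rabs_le. split.
  + assert (t * - ln t <= t * (/ t - 1)) by (apply Rmult_le_compat_l; lra).
    rewrite Rmult_minus_distr_l, Rinv_r in H by lra. nra.
  + nra.
- subst t. rewrite Rmult_0_l, Rabs_R0. lra.
Qed.

Definition weight (y : R) : R := ln (1 / y) * ln (ln (1 / y)).

Lemma weight_nonpos (y : R) : y <= 0 -> weight y = 0.
Proof.
intros Hy. unfold weight. rewrite (ln_nonpos (1 / y)); [ring|].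
destruct Hy as [Hy|Hy].
- pose proof (Rinv_lt_0_compat y Hy). lra.
- rewrite Hy. unfold Rdiv. rewrite Rinv_0. lra.
Qed.

Lemma continuous_weight (x : R) : x <> 0 -> continuous weight x.
Proof.
intros Hx. destruct (Rtotal_order x 0) as [Hx0|[Hx0|Hx0]]; [|lra|].
- apply continuous_eq_locally with (fun _ => 0).
  + generalize (locally_lt 0 x Hx0). apply filter_imp. intros y Hy.
    rewrite weight_nonpos by lra. ring.
  + apply continuous_const.
- apply (continuous_comp (fun y => ln (1 / y)) (fun t => t * ln t)).
  + apply continuous_of_derive. auto_derive. pose proof (Rinv_0_lt_compat x Hx0).
    repeat split; lra.
  + apply continuous_x_ln_x.
Qed.

(** With [t = ln (1 / y)], the crude bound [t ^ 2 + 1] for the weight suffices at [0]: for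
    [s = sqrt y] one has [t = - 2 ln s], so [y (t ^ 2 + 1) = 4 (s ln s) ^ 2 + y], which tends to
    [0]. *)
Lemma continuous_x_weight (x : R) : continuous (fun y => y * weight y) x.
Proof.
destruct (Req_dec x 0) as [Hx|Hx].
- subst x. apply continuous_dominated with
    (fun y => 4 * (sqrt (Rabs y) * ln (sqrt (Rabs y))) ^ 2 + Rabs y).
  + apply (continuous_plus (fun y => 4 * (sqrt (Rabs y) * ln (sqrt (Rabs y))) ^ 2) Rabs).
    * apply (continuous_comp (fun y => sqrt (Rabs y) * ln (sqrt (Rabs y)))
        (fun u => 4 * u ^ 2)).
      -- apply (continuous_comp (fun y => sqrt (Rabs y)) (fun s => s * ln s)).
         ++ apply continuous_sqrt_comp. apply continuous_Rabs.
         ++ apply continuous_x_ln_x.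
      -- apply continuous_of_derive. auto_derive. trivial.
    * apply continuous_Rabs.
  + rewrite Rabs_R0, sqrt_0. ring.
  + generalize (locally_lt 1 0 Rlt_0_1). apply filter_imp. intros y Hy.
    destruct (Rle_or_lt y 0) as [Hy0|Hy0].
    { rewrite weight_nonpos, Rmult_0_r, Rabs_R0 by lra.
      pose proof (Rabs_pos y). pose proof (pow2_ge_0 (sqrt (Rabs y) * ln (sqrt (Rabs y)))).
      lra. }
    rewrite (Rabs_pos_eq y), Rabs_mult, (Rabs_pos_eq y) by lra.
    pose proof (sqrt_lt_R0 y Hy0) as Hs. pose proof (sqrt_sqrt y (Rlt_le _ _ Hy0)) as Hss.
    set (s := sqrt y) in *.
    assert (Hl : ln (1 / y) = - (2 * ln s)).
    { unfold Rdiv. rewrite Rmult_1_l, ln_Rinv, <- Hss, ln_mult by lra. ring. }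
    assert (0 <= ln (1 / y)).
    { unfold Rdiv. rewrite Rmult_1_l, ln_Rinv by lra.
      pose proof (ln_le_sub_1 y Hy0). lra. }
    unfold weight. pose proof (Rabs_x_ln_x_le (ln (1 / y)) H).
    apply Rle_trans with (y * (ln (1 / y) ^ 2 + 1)).
    { apply Rmult_le_compat_l; lra. }
    rewrite Hl, <- Hss. right. ring.
- apply (continuous_mult (fun y => y) weight).
  + apply continuous_id.
  + apply continuous_weight; exact Hx.
Qed.

Lemma continuity_pt_of_derive (f : R -> R) (x : R) : ex_derive f x -> continuity_pt f x.
Proof. intros H. apply continuity_pt_filterlim. exact (continuous_of_derive f x H). Qed.

(** * Gauss's integral for Euler's constant *)

(** The value [1 / 2] is the limit at [1]. At [0] the defaults [ln 0 = 0] and [/ 0 = 0] give [1],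
    which is already the limit there. *)
Definition gauss_kernel (u : R) : R :=
  if Req_EM_T u 1 then 1 / 2 else / (1 - u) + / ln u.

Lemma gauss_kernel_neq (u : R) : u <> 1 -> gauss_kernel u = / (1 - u) + / ln u.
Proof. intros Hu. unfold gauss_kernel. destruct (Req_EM_T u 1); [contradiction|reflexivity]. Qed.

(** Inverting [1 - u <= - ln u <= 1 / u - 1] gives both bounds, because
    [1 / (1 / u - 1) = 1 / (1 - u) - 1]. *)
Lemma gauss_kernel_bounds (u : R) : 0 <= u <= 1 -> 0 <= gauss_kernel u <= 1.
Proof.
intros [H0 H1]. unfold gauss_kernel. destruct (Req_EM_T u 1) as [E|E]; [lra|].
destruct H0 as [H0|H0].
- pose proof (ln_le_sub_1 u H0) as L1.
  pose proof (ln_le_sub_1 (/ u) (Rinv_0_lt_compat _ H0)) as L2.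
  rewrite ln_Rinv in L2 by lra.
  assert (H2 : / (- ln u) <= / (1 - u)) by (apply Rinv_le_contravar; lra).
  assert (H3 : / (/ u - 1) <= / (- ln u)) by (apply Rinv_le_contravar; lra).
  rewrite Rinv_opp in H2, H3.
  replace (/ (/ u - 1)) with (/ (1 - u) - 1) in H3 by (field; lra). lra.
- rewrite <- H0, ln_nonpos, Rinv_0, Rminus_0_r by lra. lra.
Qed.

Lemma ln_1p_expansion (h : R) : Rabs h <= / 4 ->
  Rabs (ln (1 + h) - h + h ^ 2 / 2) <= 2 * Rabs h ^ 3.
Proof.
intros Hh.
destruct (MVT_gen (fun h => ln (1 + h) - h + h ^ 2 / 2) 0 h (fun h => h ^ 2 / (1 + h)))
  as [c [Hc He]].
- intros x Hx. assert (Rabs x <= / 4).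
  { revert Hx. unfold Rmin, Rmax. destruct (Rle_dec 0 h); apply Rabs_le_between in Hh;
      intros; apply Rabs_le_between; lra. }
  apply Rabs_le_between in H. auto_derive; [lra|]. field. lra.
- intros x Hx. assert (Rabs x <= / 4).
  { revert Hx. unfold Rmin, Rmax. destruct (Rle_dec 0 h); apply Rabs_le_between in Hh;
      intros; apply Rabs_le_between; lra. }
  apply Rabs_le_between in H. apply continuity_pt_of_derive. auto_derive. lra.
- assert (Hc' : Rabs c <= Rabs h).
  { revert Hc. unfold Rmin, Rmax. destruct (Rle_dec 0 h); intros;
      [rewrite !Rabs_pos_eq | rewrite !Rabs_left1]; lra. }
  rewrite Rplus_0_r, ln_1 in He.
  replace (ln (1 + h) - h + h ^ 2 / 2) with (c ^ 2 / (1 + c) * h) by lra.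
  pose proof (Rabs_pos c). assert (Rabs c <= / 4) by lra.
  apply Rabs_le_between in H0.
  rewrite Rabs_mult. unfold Rdiv. rewrite Rabs_mult, <- RPow_abs.
  rewrite (Rabs_pos_eq (/ (1 + c))) by (left; apply Rinv_0_lt_compat; lra).
  assert (/ (1 + c) <= 2).
  { replace 2 with (/ (/ 2)) by field. apply Rinv_le_contravar; lra. }
  assert (0 < / (1 + c)) by (apply Rinv_0_lt_compat; lra).
  pose proof (Rabs_pos h).
  assert (Rabs c ^ 2 <= Rabs h ^ 2) by (apply pow_incr; lra).
  assert (0 <= Rabs c ^ 2) by (apply pow_le; lra).
  replace (2 * Rabs h ^ 3) with (Rabs h ^ 2 * 2 * Rabs h) by ring.
  apply Rmult_le_compat_r; [lra|]. apply Rmult_le_compat; lra.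
Qed.

(** With [h = u - 1] and [ln (1 + h) = h - h ^ 2 / 2 + rho], the terms in [h ^ 2] cancel in the
    numerator over [2 h ln (1 + h)]. A numerator of at most [6 |h| ^ 3] over a denominator of at
    least [(3 / 2) h ^ 2] yields the constant [4]. *)
Lemma gauss_kernel_near_1 (u : R) : Rabs (u - 1) <= / 4 ->
  Rabs (gauss_kernel u - 1 / 2) <= 4 * Rabs (u - 1).
Proof.
intros Hu. destruct (Req_dec u 1) as [E|E].
- unfold gauss_kernel. destruct (Req_EM_T u 1); [|contradiction].
  rewrite Rminus_diag, Rabs_R0. pose proof (Rabs_pos (u - 1)). lra.
- rewrite gauss_kernel_neq by exact E.
  set (h := u - 1) in *. replace u with (1 + h) by (unfold h; ring).
  assert (Hh0 : h <> 0) by (unfold h; lra). clearbody h.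
  pose proof (ln_1p_expansion h Hu) as HL. set (L := ln (1 + h)) in *.
  set (rho := L - h + h ^ 2 / 2) in *.
  pose proof (Rabs_pos_lt h Hh0) as Ha. set (a := Rabs h) in *.
  assert (Ha2 : h ^ 2 = a ^ 2) by (unfold a; rewrite RPow_abs, Rabs_pos_eq; [reflexivity|apply pow2_ge_0]).
  assert (HLl : 3 / 4 * a <= Rabs L).
  { replace L with (h - (h ^ 2 / 2 - rho)) by (unfold rho; ring).
    apply Rle_trans with (a - Rabs (h ^ 2 / 2 - rho)); [|apply Rabs_triang_inv].
    assert (Rabs (h ^ 2 / 2 - rho) <= a ^ 2 / 2 + 2 * a ^ 3).
    { eapply Rle_trans; [apply Rabs_triang|]. rewrite Rabs_Ropp, Ha2.
      rewrite (Rabs_pos_eq (a ^ 2 / 2)) by nra. lra. }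
    assert (a ^ 2 <= / 4 * a) by nra.
    assert (a ^ 3 <= / 16 * a) by nra. lra. }
  assert (HL0 : L <> 0).
  { intros E0. rewrite E0, Rabs_R0 in HLl. lra. }
  replace (/ (1 - (1 + h)) + / L - 1 / 2) with ((h ^ 3 / 2 - (2 + h) * rho) / (2 * h * L))
    by (unfold rho; field; split; lra).
  unfold Rdiv at 1. rewrite Rabs_mult, Rabs_inv, !Rabs_mult. fold a.
  rewrite (Rabs_pos_eq 2) by lra.
  assert (0 < 2 * a * Rabs L) by (apply Rmult_lt_0_compat; lra).
  apply Rmult_le_reg_r with (2 * a * Rabs L); [exact H|].
  rewrite Rmult_assoc, Rinv_l, Rmult_1_r by lra.
  apply Rle_trans with (6 * a ^ 3).
  + eapply Rle_trans; [apply Rabs_triang|]. rewrite Rabs_Ropp.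
    unfold Rdiv. rewrite !Rabs_mult, <- RPow_abs. fold a. rewrite (Rabs_pos_eq (/ 2)) by lra.
    assert (Rabs (2 + h) <= 9 / 4).
    { apply Rabs_le_between. unfold a in Hu. apply Rabs_le_between in Hu. lra. }
    pose proof (Rabs_pos (2 + h)). pose proof (Rabs_pos rho).
    assert (Rabs (2 + h) * Rabs rho <= 9 / 4 * (2 * a ^ 3)) by (apply Rmult_le_compat; lra).
    assert (0 < a ^ 3) by (apply pow_lt; lra). lra.
  + assert (a * a * (3 / 4 * a) <= a * a * Rabs L) by (apply Rmult_le_compat_l; nra). nra.
Qed.

Lemma continuous_gauss_kernel (u : R) : continuous gauss_kernel u.
Proof.
destruct (Req_dec u 1) as [E1|E1].
- subst u. apply continuous_eq_locally with (fun u => (gauss_kernel u - 1 / 2) + 1 / 2).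
  { apply filter_forall. intros y. ring. }
  apply (continuous_plus (fun u => gauss_kernel u - 1 / 2) (fun _ => 1 / 2));
    [|apply continuous_const].
  apply continuous_dominated with (fun u => 4 * Rabs (u - 1)).
  + apply (continuous_comp (fun u => u - 1) (fun v => 4 * Rabs v)).
    * apply continuous_of_derive. auto_derive. trivial.
    * apply (continuous_mult (fun _ => 4) Rabs); [apply continuous_const|apply continuous_Rabs].
  + rewrite Rminus_diag, Rabs_R0. ring.
  + assert (H4 : 0 < / 4) by lra. exists (mkposreal _ H4). intros y Hy. 
    apply gauss_kernel_near_1. left. exact Hy.
- apply continuous_eq_locally with (fun u => / (1 - u) + / ln u).
  { destruct (Rdichotomy _ _ E1) as [H|H].
    - generalize (locally_lt 1 u H). apply filter_imp. intros y Hy.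
      apply gauss_kernel_neq. lra.
    - generalize (locally_gt 1 u H). apply filter_imp. intros y Hy.
      apply gauss_kernel_neq. lra. }
  apply (continuous_plus (fun u => / (1 - u)) (fun u => / ln u)).
  { apply continuous_of_derive. auto_derive. lra. }
  destruct (Rtotal_order u 0) as [H|[H|H]].
  + apply continuous_eq_locally with (fun _ => 0); [|apply continuous_const].
    generalize (locally_lt 0 u H). apply filter_imp. intros y Hy.
    rewrite ln_nonpos by lra. apply Rinv_0.
  + subst u. apply filterlim_locally. intros eps.
    generalize (locally_lt (exp (- / eps)) 0 (exp_pos _)). apply filter_imp. intros y Hy.
    change (Rabs (/ ln y - / ln 0) < eps).
    rewrite (ln_nonpos 0), Rinv_0, Rminus_0_r by lra.
    pose proof (cond_pos eps) as He. pose proof (Rinv_0_lt_compat _ He) as Hi.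
    destruct (Rle_or_lt y 0) as [Hy0|Hy0].
    { rewrite ln_nonpos, Rinv_0, Rabs_R0 by lra. exact He. }
    assert (Hl : ln y < - / eps) by (rewrite <- (ln_exp (- / eps)); apply ln_increasing; lra).
    rewrite Rabs_inv, Rabs_left by lra.
    rewrite <- (Rinv_inv eps). apply Rinv_lt_contravar; [|lra].
    apply Rmult_lt_0_compat; lra.
  + apply continuous_of_derive. auto_derive. split; [lra|]. split; [|trivial].
    apply ln_neq_0; lra.
Qed.

Lemma ex_RInt_gauss_kernel (a b : R) : ex_RInt gauss_kernel a b.
Proof. apply (ex_RInt_continuous (V := R_CompleteNormedModule)). intros; apply continuous_gauss_kernel. Qed.

Definition gauss_primitive (x : R) : R := RInt gauss_kernel 0 x.

Lemma is_derive_gauss_primitive (x : R) :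
  is_derive gauss_primitive x (gauss_kernel x).
Proof.
apply (is_derive_RInt gauss_kernel _ 0).
- apply filter_forall. intros y. apply (RInt_correct gauss_kernel 0 y), ex_RInt_gauss_kernel.
- apply continuous_gauss_kernel.
Qed.

Lemma gauss_primitive_0 : gauss_primitive 0 = 0.
Proof. apply (RInt_point 0 gauss_kernel). Qed.

(** A form of [(1 - u ^ (n + 1)) / (1 - u)] that stays regular at [1]: its logarithm replaces a
    difference of two logarithms that diverge there, and its value [n + 1] at [1] is the source of
    the term [ln (n + 1)]. *)
Definition geom (n : nat) (u : R) : R := sum_n (fun j => u ^ j) n.

Lemma geom_mult (n : nat) (u : R) : (1 - u) * geom n u = 1 - u ^ S n.
Proof.
unfold geom. induction n as [|n IH].
- rewrite sum_O. simpl. ring.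
- rewrite sum_Sn. unfold plus; simpl plus. change ((1 - u) * (sum_n (fun j => u ^ j) n + u ^ S n) = 1 - u ^ S (S n)).
  rewrite Rmult_plus_distr_l, IH. simpl. ring.
Qed.

Lemma geom_ge_1 (n : nat) (u : R) : 0 <= u -> 1 <= geom n u.
Proof.
intros Hu. unfold geom. induction n as [|n IH].
- rewrite sum_O. simpl. lra.
- rewrite sum_Sn. change (1 <= sum_n (fun j => u ^ j) n + u ^ S n).
  pose proof (pow_le u (S n) Hu). lra.
Qed.

Lemma geom_1 (n : nat) : geom n 1 = INR (S n).
Proof.
unfold geom. rewrite (sum_n_ext _ (fun _ => 1)) by (intros; apply pow1).
rewrite sum_n_const. ring.
Qed.

Lemma ex_derive_geom (n : nat) (u : R) : ex_derive (geom n) u.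
Proof.
apply ex_derive_ext with (fun u => sum_n (fun j => u ^ j) n); [reflexivity|].
apply (ex_derive_sum_n (fun j u => u ^ j)). intros k _. auto_derive. trivial.
Qed.

Lemma ln_geom (n : nat) (u : R) : 0 < u < 1 ->
  ln (geom n u) = ln (1 - u ^ S n) - ln (1 - u).
Proof.
intros Hu. rewrite <- geom_mult. assert (1 <= geom n u) by (apply geom_ge_1; lra). rewrite ln_mult by lra. ring.
Qed.

Lemma pow_lt_1 (n : nat) (u : R) : 0 <= u < 1 -> u ^ S n < 1.
Proof. intros Hu. apply pow_lt_1_compat; [lra|lia]. Qed.

Lemma is_derive_ln_geom (n : nat) (u : R) : 0 < u < 1 ->
  is_derive (fun u => ln (geom n u)) u (/ (1 - u) - INR (S n) * u ^ n / (1 - u ^ S n)).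
Proof.
intros Hu.
apply is_derive_ext_loc with (fun u => ln (1 - u ^ S n) - ln (1 - u)).
- generalize (filter_and _ _ (locally_gt 0 u (proj1 Hu)) (locally_lt 1 u (proj2 Hu))).
  apply filter_imp. intros y Hy. symmetry. apply ln_geom. exact Hy.
- assert (u ^ S n < 1) by (apply pow_lt_1; lra). auto_derive.
  + cbn [pow] in *. repeat split; lra.
  + change (match n with 0%nat => 1 | S _ => INR n + 1 end) with (INR (S n)).
    cbn [pow] in *. field. lra.
Qed.

Lemma is_derive_sum_pow_div (n : nat) (u : R) :
  is_derive (fun u => sum_n (fun j => u ^ S j / INR (S j)) n) u (geom n u).
Proof.
apply (is_derive_sum_n (fun j u => u ^ S j / INR (S j))). intros k _.
auto_derive; [trivial|]. change (match k with 0%nat => 1 | S _ => INR k + 1 end) with (INR (S k)). field.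
apply not_0_INR. lia.
Qed.

(** The chain rule factor [n + 1] cancels against [ln (u ^ (n + 1)) = (n + 1) ln u], so the
    logarithmic part of the kernel keeps the plain form [u ^ n / ln u]. *)
Lemma is_derive_gauss_primitive_pow (n : nat) (u : R) : 0 < u < 1 ->
  is_derive (fun u => gauss_primitive (u ^ S n)) u
    (INR (S n) * u ^ n / (1 - u ^ S n) + u ^ n / ln u).
Proof.
intros Hu. assert (u ^ S n < 1) by (apply pow_lt_1; lra).
assert (0 < u ^ S n) by (apply pow_lt; lra).
assert (Hl : ln u < 0) by (rewrite <- ln_1; apply ln_increasing; lra).
replace (INR (S n) * u ^ n / (1 - u ^ S n) + u ^ n / ln u)
  with (scal (INR (S n) * u ^ n) (gauss_kernel (u ^ S n))).
- apply (is_derive_comp gauss_primitive (fun u => u ^ S n)).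
  + apply is_derive_gauss_primitive.
  + auto_derive; [trivial|]. change (match n with 0%nat => 1 | S _ => INR n + 1 end) with (INR (S n)). ring.
- rewrite gauss_kernel_neq, ln_pow by lra. real_eq.
  change (INR (S n) * u ^ n * (/ (1 - u ^ S n) + / (INR (S n) * ln u))
    = INR (S n) * u ^ n / (1 - u ^ S n) + u ^ n / ln u).
  assert (INR (S n) <> 0) by (apply not_0_INR; lia).
  field. repeat split; lra.
Qed.

Lemma continuous_gauss_primitive_pow (n : nat) (u : R) :
  continuous (fun u => gauss_primitive (u ^ n)) u.
Proof.
apply continuous_of_derive. eexists.
apply (is_derive_comp gauss_primitive (fun u => u ^ n)).
- apply is_derive_gauss_primitive.
- auto_derive; [trivial|]. reflexivity.
Qed.

Lemma continuous_ln_geom (n : nat) (u : R) : 0 <= u -> continuous (fun u => ln (geom n u)) u.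
Proof.
intros Hu. apply continuous_of_derive. pose proof (geom_ge_1 n u Hu).
apply (ex_derive_comp ln (geom n)); [|apply ex_derive_geom].
eexists. apply is_derive_ln. lra.
Qed.

Lemma ln_geom_0 (n : nat) : ln (geom n 0) = 0.
Proof.
pose proof (geom_mult n 0) as H. rewrite pow_i in H by lia.
replace (geom n 0) with 1 by lra. apply ln_1.
Qed.

Lemma is_RInt_pow_unit (n : nat) : is_RInt (fun u => u ^ n) 0 1 (/ INR (S n)).
Proof.
replace (/ INR (S n)) with (1 ^ S n / INR (S n) - 0 ^ S n / INR (S n)).
- apply is_RInt_antiderivative with (F := fun u => u ^ S n / INR (S n)); [lra|..]; intros x _.
  + apply continuous_of_derive. auto_derive. trivial.
  + apply continuous_of_derive. auto_derive. trivial.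
  + auto_derive; [trivial|]. change (match n with 0%nat => 1 | S _ => INR n + 1 end) with (INR (S n)). field. apply not_0_INR. lia.
- rewrite pow1, pow_i by lia. field. apply not_0_INR. lia.
Qed.

(* [1/(1-u)] integrated against [1 - u^(n+1)] gives the harmonic sum, and the [1/ln u] parts scale by
   [u -> u^(n+1)], leaving [ln (n+1)]; the error is an integral of [u^n (kernel - 1)]. *)
Lemma gauss_primitive_1_approx (n : nat) :
  Rabs (gauss_primitive 1 - (sum_n (fun k => / INR (S k)) n - ln (INR (S n)))) <= / INR (S n).
Proof.
set (f := fun u => gauss_kernel u - u ^ n * gauss_kernel u + u ^ n).
set (F := fun u => sum_n (fun j => u ^ S j / INR (S j)) n + gauss_primitive u
  - gauss_primitive (u ^ S n) - ln (geom n u)).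
assert (HF : is_RInt f 0 1 (F 1 - F 0)).
{ apply is_RInt_antiderivative; [lra|..].
  - intros x _. unfold f.
    apply (continuous_plus (fun u => gauss_kernel u - u ^ n * gauss_kernel u) (fun u => u ^ n)).
    + apply (continuous_minus gauss_kernel (fun u => u ^ n * gauss_kernel u)).
      * apply continuous_gauss_kernel.
      * apply (continuous_mult (fun u => u ^ n) gauss_kernel).
        -- apply continuous_of_derive. auto_derive. trivial.
        -- apply continuous_gauss_kernel.
    + apply continuous_of_derive. auto_derive. trivial.
  - intros x Hx. unfold F.
    apply (continuous_minus (fun u => sum_n (fun j => u ^ S j / INR (S j)) n + gauss_primitive u
      - gauss_primitive (u ^ S n)) (fun u => ln (geom n u)));
      [|apply continuous_ln_geom; lra].
    apply (continuous_minus (fun u => sum_n (fun j => u ^ S j / INR (S j)) n + gauss_primitive u)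
      (fun u => gauss_primitive (u ^ S n))); [|apply continuous_gauss_primitive_pow].
    apply continuous_of_derive.
    eexists. apply (is_derive_plus (fun u => sum_n (fun j => u ^ S j / INR (S j)) n) gauss_primitive).
    + apply is_derive_sum_pow_div.
    + apply is_derive_gauss_primitive.
  - intros x Hx. unfold F, f.
    assert (Hl : ln x < 0) by (rewrite <- ln_1; apply ln_increasing; lra).
    assert (x ^ S n < 1) by (apply pow_lt_1; lra).
    evar_last.
    + apply (is_derive_minus (fun u => sum_n (fun j => u ^ S j / INR (S j)) n + gauss_primitive u
        - gauss_primitive (u ^ S n)) (fun u => ln (geom n u))); [|apply is_derive_ln_geom; lra].
      apply (is_derive_minus (fun u => sum_n (fun j => u ^ S j / INR (S j)) n + gauss_primitive u)
        (fun u => gauss_primitive (u ^ S n))); [|apply is_derive_gauss_primitive_pow; lra].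
      apply (is_derive_plus (fun u => sum_n (fun j => u ^ S j / INR (S j)) n) gauss_primitive).
      * apply is_derive_sum_pow_div.
      * apply is_derive_gauss_primitive.
    + unfold minus, plus, opp; cbn -[INR pow geom]. real_eq.
      rewrite gauss_kernel_neq by lra.
      replace (geom n x) with ((1 - x ^ S n) / (1 - x)) by (rewrite <- geom_mult; field; lra).
      cbn [pow] in *. field. repeat split; lra. }
(* At [1] the two occurrences of [gauss_primitive] cancel; at [0] every term vanishes. *)
assert (E : F 1 - F 0 = sum_n (fun k => / INR (S k)) n - ln (INR (S n))).
{ unfold F. rewrite geom_1, ln_geom_0, pow1, pow_i, gauss_primitive_0 by lia.
  rewrite (sum_n_ext (fun j => 1 ^ S j / INR (S j)) (fun k => / INR (S k)))
    by (intros; rewrite pow1; unfold Rdiv; real_eq; ring).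
  rewrite (sum_n_ext (fun j => 0 ^ S j / INR (S j)) (fun k => 0))
    by (intros; rewrite pow_i by lia; unfold Rdiv; real_eq; ring).
  rewrite sum_n_const. ring. }
rewrite E in HF. clear E F.
assert (HG : is_RInt gauss_kernel 0 1 (gauss_primitive 1))
  by apply (RInt_correct gauss_kernel 0 1), ex_RInt_gauss_kernel.
pose proof (is_RInt_minus _ _ _ _ _ _ HG HF) as HD.
pose proof (is_RInt_pow_unit n) as HP.
assert (0 < / INR (S n)) by (apply Rinv_0_lt_compat, lt_0_INR; lia).
apply Rabs_le. split.
- apply (is_RInt_le (fun u => - u ^ n) _ 0 1 (- / INR (S n)) _ Rle_0_1 (is_RInt_opp _ _ _ _ HP) HD).
  intros x Hx. unfold f, minus, plus, opp; simpl.
  assert (0 <= gauss_kernel x <= 1) by (apply gauss_kernel_bounds; lra).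
  assert (0 < x ^ n) by (apply pow_lt; lra). nra.
- apply (is_RInt_le _ (fun u => u ^ n) 0 1 _ (/ INR (S n)) Rle_0_1 HD HP).
  intros x Hx. unfold f, minus, plus, opp; simpl.
  assert (0 <= gauss_kernel x <= 1) by (apply gauss_kernel_bounds; lra).
  assert (0 < x ^ n) by (apply pow_lt; lra). nra.
Qed.

Lemma gauss_primitive_1 : gauss_primitive 1 = euler_gamma.
Proof.
unfold euler_gamma.
rewrite (is_lim_seq_unique _ (gauss_primitive 1)); [reflexivity|].
apply is_lim_seq_spec. intros eps.
destruct (archimed_cor1 eps (cond_pos eps)) as [N [HN HN0]].
exists N. intros n Hn. rewrite Rabs_minus_sym.
eapply Rle_lt_trans; [apply gauss_primitive_1_approx|].
eapply Rle_lt_trans; [|apply HN].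
apply Rinv_le_contravar; [apply lt_0_INR; lia|apply le_INR; lia].
Qed.

(** * Moments of the weight *)

(** Taking logarithms in [1 - y <= ln (1 / y) <= (1 - y) / y]. Thus [ln (ln (1 / y))] and
    [ln (1 - y)] have the same singularity at [1]. *)
Lemma ln_ratio_bounds (y : R) : 0 < y < 1 ->
  0 <= ln (ln (1 / y)) - ln (1 - y) <= ln (1 / y).
Proof.
intros Hy. unfold Rdiv. rewrite Rmult_1_l.
assert (Hi : 0 < / y) by (apply Rinv_0_lt_compat; lra).
pose proof (ln_le_sub_1 y (proj1 Hy)) as L1. pose proof (ln_le_sub_1 (/ y) Hi) as L2.
assert (Ht : 1 - y <= ln (/ y)) by (rewrite ln_Rinv; lra).
split.
- pose proof (ln_le (1 - y) (ln (/ y))). lra.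
- pose proof (ln_le (ln (/ y)) (/ y - 1)).
  replace (/ y - 1) with (/ y * (1 - y)) in H at 2 by (field; lra).
  rewrite ln_mult in H by lra. lra.
Qed.

(** At [s = k ln (1 / y)] the product [exp (- s) * (s + 1)] is the coefficient of [ln (ln (1 / y))]
    in [weight_primitive_core]; its distance [O(s)] to [1] outweighs the logarithmic singularity at
    [y = 1]. *)
Lemma one_add_exp_opp_bounds (s : R) : 0 <= s -> 0 <= 1 - exp (- s) * (s + 1) <= s.
Proof.
intros Hs. pose proof (exp_pos (- s)) as Hp.
pose proof (exp_ineq1_le s) as H1. pose proof (exp_ineq1_le (- s)) as H2.
assert (He : exp (- s) * exp s = 1) by (rewrite <- exp_plus, Rplus_opp_l; apply exp_0).
split; nra.
Qed.

Lemma pow_eq_exp_ln_inv (y : R) (k : nat) : 0 < y -> y ^ k = exp (- (INR k * ln (1 / y))).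
Proof.
intros Hy. unfold Rdiv. rewrite Rmult_1_l, ln_Rinv by lra.
rewrite <- (exp_ln (y ^ k)) by (apply pow_lt; lra). rewrite ln_pow by lra.
f_equal. ring.
Qed.

(* [k^2 V ln ln (1/y) - ln (1-y)], where [V' = y^(k-1) ln (1/y)] and [V 0 = 0]; the last term cancels
   the singularity at [1]. The junk values [ln x = 0] for [x <= 0] make this function vanish for
   [y >= 1], so that it is continuous at [1] on both sides. *)
Definition weight_primitive_core (k : nat) (y : R) : R :=
  y ^ k * (INR k * ln (1 / y) + 1) * ln (ln (1 / y)) - ln (1 - y).

Lemma ln_inv_nonpos (y : R) : 1 <= y -> ln (1 / y) <= 0.
Proof.
intros Hy. unfold Rdiv. rewrite Rmult_1_l, ln_Rinv by lra.
pose proof (ln_le 1 y). rewrite ln_1 in H. lra.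
Qed.

Lemma ln_inv_pos (y : R) : 0 < y < 1 -> 0 < ln (1 / y).
Proof.
intros Hy. unfold Rdiv. rewrite Rmult_1_l, ln_Rinv by lra.
pose proof (ln_le_sub_1 y). lra.
Qed.

Lemma continuous_ln_inv (y : R) : 0 < y -> continuous (fun y => ln (1 / y)) y.
Proof.
intros Hy. apply continuous_of_derive. auto_derive.
pose proof (Rinv_0_lt_compat y Hy). repeat split; lra.
Qed.

Lemma weight_primitive_core_ge_1 (k : nat) (y : R) : 1 <= y -> weight_primitive_core k y = 0.
Proof.
intros Hy. unfold weight_primitive_core.
rewrite (ln_nonpos (ln (1 / y))) by (apply ln_inv_nonpos; exact Hy).
rewrite (ln_nonpos (1 - y)) by lra. ring.
Qed.

Lemma weight_primitive_core_bound (k : nat) (y : R) : 0 < y < 1 ->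
  Rabs (weight_primitive_core k y)
    <= INR k * Rabs (ln (1 / y) * ln (ln (1 / y))) + Rabs (ln (1 / y)).
Proof.
intros Hy. pose proof (ln_ratio_bounds y Hy) as Hr.
pose proof (ln_inv_pos y Hy) as Ht. unfold weight_primitive_core.
rewrite pow_eq_exp_ln_inv by lra. set (t := ln (1 / y)) in *.
pose proof (pos_INR k) as Hk.
pose proof (one_add_exp_opp_bounds (INR k * t)) as He.
assert (0 <= INR k * t) by (apply Rmult_le_pos; lra). specialize (He H).
set (e := exp (- (INR k * t)) * (INR k * t + 1)) in *.
(* The first part is at most [k t |ln t|] and the second at most [t]; both bounds vanish at
   [y = 1]. *)
replace (e * ln t - ln (1 - y)) with (- ((1 - e) * ln t) + (ln t - ln (1 - y))) by ring.
eapply Rle_trans; [apply Rabs_triang|]. rewrite Rabs_Ropp, Rabs_mult.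
rewrite (Rabs_pos_eq (1 - e)), (Rabs_pos_eq (ln t - ln (1 - y))), (Rabs_pos_eq t) by lra.
rewrite Rabs_mult, (Rabs_pos_eq t), <- Rmult_assoc by lra.
apply Rplus_le_compat; [|lra]. apply Rmult_le_compat_r; [apply Rabs_pos|lra].
Qed.

(** The positive exponent [S k] supplies the factor [y] in [y * weight y] and in
    [y * ln (ln (1 / y))], which settles every point below [1]; at [1] the preceding bound takes
    over. *)
Lemma continuous_weight_primitive_core (k : nat) (x : R) : x <= 1 ->
  continuous (weight_primitive_core (S k)) x.
Proof.
intros [Hx|Hx].
- apply continuous_eq_locally with (fun y =>
    INR (S k) * y ^ k * (y * weight y) + y ^ k * (y * ln (ln (1 / y))) - ln (1 - y)).
  { apply filter_forall. intros y. unfold weight_primitive_core, weight. cbn [pow]. real_eq. ring. }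
  apply (continuous_minus (fun y => INR (S k) * y ^ k * (y * weight y)
    + y ^ k * (y * ln (ln (1 / y)))) (fun y => ln (1 - y))).
  + apply (continuous_plus (fun y => INR (S k) * y ^ k * (y * weight y))
      (fun y => y ^ k * (y * ln (ln (1 / y))))).
    * apply (continuous_mult (fun y => INR (S k) * y ^ k) (fun y => y * weight y)).
      -- apply continuous_of_derive. auto_derive. trivial.
      -- apply continuous_x_weight.
    * apply (continuous_mult (fun y => y ^ k) (fun y => y * ln (ln (1 / y)))).
      -- apply continuous_of_derive. auto_derive. trivial.
      -- apply continuous_x_lnln. exact Hx.
  + apply continuous_of_derive. auto_derive. lra.
- subst x. apply continuous_dominated with
    (fun y => INR (S k) * Rabs (ln (1 / y) * ln (ln (1 / y))) + Rabs (ln (1 / y))).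
  + apply (continuous_plus (fun y => INR (S k) * Rabs (ln (1 / y) * ln (ln (1 / y))))
      (fun y => Rabs (ln (1 / y)))).
    * apply (continuous_mult (fun _ => INR (S k))
        (fun y => Rabs (ln (1 / y) * ln (ln (1 / y))))); [apply continuous_const|].
      apply (continuous_comp weight Rabs); [apply continuous_weight; lra|apply continuous_Rabs].
    * apply (continuous_comp (fun y => ln (1 / y)) Rabs);
        [apply continuous_ln_inv; lra|apply continuous_Rabs].
  + replace (1 / 1) with 1 by field. rewrite ln_1, Rmult_0_l, Rabs_R0. ring.
  + generalize (locally_gt 0 1 Rlt_0_1). apply filter_imp. intros y Hy.
    destruct (Rle_or_lt 1 y) as [H1|H1].
    * rewrite weight_primitive_core_ge_1, Rabs_R0 by exact H1.
      pose proof (Rabs_pos (ln (1 / y) * ln (ln (1 / y)))).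
      pose proof (Rabs_pos (ln (1 / y))). pose proof (pos_INR (S k)). nra.
    * apply weight_primitive_core_bound. lra.
Qed.

Lemma weight_primitive_core_0 (k : nat) : weight_primitive_core (S k) 0 = 0.
Proof.
unfold weight_primitive_core. rewrite pow_i, Rminus_0_r, ln_1 by lia. ring.
Qed.

Lemma is_RInt_weight_moment (j : nat) :
  is_RInt (fun y => y ^ j * (y * weight y)) 0 1
    ((1 - euler_gamma - ln (INR (j + 2))) / INR (j + 2) ^ 2).
Proof.
set (k := S j).
assert (Hk : INR (j + 2) = INR (S k)) by (f_equal; unfold k; lia). rewrite Hk.
assert (Hk0 : 0 < INR (S k)) by (apply lt_0_INR; lia).
(* Write [c] for [S k], that is [j + 2]. The derivative of the core is [c^2 y^(c-1) weight y] plus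
   [- c y^(c-1) - y^(c-1) / ln (1/y) + 1 / (1-y)]. The term [y^c] removes the first extra summand,
   [gauss_primitive (y^c)] trades the second for [- c y^(c-1) / (1 - y^c)], and [ln (geom k y)]
   cancels what remains. At [1] the four terms contribute [0], [1], [- euler_gamma] and [- ln c]. *)
set (F := fun y => (weight_primitive_core (S k) y + y ^ S k
  - gauss_primitive (y ^ S k) - ln (geom k y)) / INR (S k) ^ 2).
replace ((1 - euler_gamma - ln (INR (S k))) / INR (S k) ^ 2) with (F 1 - F 0).
- apply is_RInt_antiderivative; [lra|..].
  + intros x Hx. apply (continuous_mult (fun y => y ^ j) (fun y => y * weight y)).
    * apply continuous_of_derive. auto_derive. trivial.
    * apply continuous_x_weight.
  + intros x Hx. unfold F.
    apply (continuous_mult (fun y => weight_primitive_core (S k) y + y ^ S k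
      - gauss_primitive (y ^ S k) - ln (geom k y)) (fun _ => / INR (S k) ^ 2));
      [|apply continuous_const].
    apply (continuous_minus (fun y => weight_primitive_core (S k) y + y ^ S k
      - gauss_primitive (y ^ S k)) (fun y => ln (geom k y)));
      [|apply continuous_ln_geom; lra].
    apply (continuous_minus (fun y => weight_primitive_core (S k) y + y ^ S k)
      (fun y => gauss_primitive (y ^ S k))); [|apply continuous_gauss_primitive_pow].
    apply (continuous_plus (weight_primitive_core (S k)) (fun y => y ^ S k)).
    * apply continuous_weight_primitive_core. lra.
    * apply continuous_of_derive. auto_derive. trivial.
  + intros x Hx. unfold F.
    assert (Hl : ln x < 0) by (rewrite <- ln_1; apply ln_increasing; lra).
    assert (Hi : 0 < / x) by (apply Rinv_0_lt_compat; lra).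
    assert (Hli : ln (1 * / x) = - ln x) by (rewrite Rmult_1_l, ln_Rinv; lra).
    assert (Hlt : x ^ S k < 1) by (apply pow_lt_1; lra).
    apply is_derive_ext with (fun y => / INR (S k) ^ 2 * (weight_primitive_core (S k) y + y ^ S k
      - gauss_primitive (y ^ S k) - ln (geom k y))).
    { intros t. real_eq. unfold Rdiv. ring. }
    evar_last.
    * apply is_derive_scal.
      apply (is_derive_minus (fun y => weight_primitive_core (S k) y + y ^ S k
        - gauss_primitive (y ^ S k)) (fun y => ln (geom k y)));
        [|apply is_derive_ln_geom; lra].
      apply (is_derive_minus (fun y => weight_primitive_core (S k) y + y ^ S k)
        (fun y => gauss_primitive (y ^ S k))); [|apply is_derive_gauss_primitive_pow; lra].
      apply (is_derive_plus (weight_primitive_core (S k)) (fun y => y ^ S k)).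
      -- unfold weight_primitive_core. auto_derive.
         ++ rewrite Hli. repeat split; lra.
         ++ reflexivity.
      -- auto_derive; [trivial|reflexivity].
    * unfold minus, plus, opp; cbn -[INR pow geom ln]. real_eq.
      unfold weight, Rdiv. rewrite Hli.
      unfold k in *.
      change (match j with 0%nat => 1 | S _ => INR j + 1 end) with (INR (S j)).
      rewrite (S_INR (S j)), (S_INR j). pose proof (pos_INR j).
      cbn [pow] in *. field. repeat split; lra.
- unfold F. rewrite weight_primitive_core_0, weight_primitive_core_ge_1 by lra.
  rewrite pow1, pow_i, gauss_primitive_0, gauss_primitive_1, geom_1, ln_geom_0 by lia.
  field. lra.
Qed.

(** * Termwise integration *)

Lemma is_RInt_sum_n (f : nat -> R -> R) (l : nat -> R) (a b : R) (N : nat) :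
  (forall m, is_RInt (f m) a b (l m)) ->
  is_RInt (fun y => sum_n (fun m => f m y) N) a b (sum_n l N).
Proof.
intros H. induction N as [|N IH].
- rewrite sum_O. apply is_RInt_ext with (f 0%nat); [|apply H].
  intros x _. rewrite sum_O. reflexivity.
- rewrite sum_Sn.
  apply is_RInt_ext with (fun y => plus (sum_n (fun m => f m y) N) (f (S N) y)).
  + intros x _. rewrite sum_Sn. reflexivity.
  + apply (is_RInt_plus (fun y => sum_n (fun m => f m y) N) (f (S N))); [exact IH|apply H].
Qed.

Lemma is_series_of_bound (u : nat -> R) (l C : R) :
  (forall N, Rabs (l - sum_n u N) <= C * / INR (S N)) -> is_series u l.
Proof.
intros H. change (is_lim_seq (sum_n u) l). apply is_lim_seq_spec. intros eps.
assert (HC : 0 < Rabs C + 1) by (pose proof (Rabs_pos C); lra).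
destruct (archimed_cor1 (eps / (Rabs C + 1))) as [N [HN HN0]].
{ apply Rdiv_lt_0_compat; [apply cond_pos|exact HC]. }
exists N. intros n Hn. rewrite Rabs_minus_sym. eapply Rle_lt_trans; [apply H|].
assert (H1 : / INR (S n) <= / INR N)
  by (apply Rinv_le_contravar; [apply lt_0_INR; lia|apply le_INR; lia]).
assert (0 < / INR (S n)) by (apply Rinv_0_lt_compat, lt_0_INR; lia).
pose proof (Rle_abs C).
apply Rle_lt_trans with ((Rabs C + 1) * / INR (S n)).
{ apply Rmult_le_compat_r; lra. }
apply Rle_lt_trans with ((Rabs C + 1) * / INR N).
{ apply Rmult_le_compat_l; lra. }
replace (pos eps) with ((Rabs C + 1) * (eps / (Rabs C + 1))) by (field; lra).
apply Rmult_lt_compat_l; lra.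
Qed.

(** After [N] the error is at most [K] times the integral of [y ^ N], that is [K / (N + 1)]. *)
Lemma is_series_RInt (a_ : nat -> R -> R) (a Q : R -> R) (K : R) :
  (forall m, ex_RInt (fun y => a_ m y * Q y) 0 1) ->
  ex_RInt (fun y => a y * Q y) 0 1 ->
  (forall y, 0 < y < 1 -> Rabs (Q y) <= K) ->
  (forall N y, 0 < y < 1 -> Rabs (a y - sum_n (fun m => a_ m y) N) <= y ^ N) ->
  is_series (fun m => RInt (fun y => a_ m y * Q y) 0 1) (RInt (fun y => a y * Q y) 0 1).
Proof.
intros Ha_ Ha HQ HR. apply is_series_of_bound with K. intros N.
pose proof (is_RInt_sum_n (fun m y => a_ m y * Q y) _ 0 1 N
  (fun m => RInt_correct _ _ _ (Ha_ m))) as HS.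
pose proof (is_RInt_minus _ _ _ _ _ _ (RInt_correct _ _ _ Ha) HS) as HD.
pose proof (is_RInt_scal _ _ _ K _ (is_RInt_pow_unit N)) as HP.
assert (Hb : forall y, 0 < y < 1 ->
  Rabs (a y * Q y - sum_n (fun m => a_ m y * Q y) N) <= K * y ^ N).
{ intros y Hy.
  replace (sum_n (fun m => a_ m y * Q y) N) with (sum_n (fun m => a_ m y) N * Q y)
    by (symmetry; exact (sum_n_mult_r (K := R_Ring) (Q y) (fun m => a_ m y) N)).
  rewrite <- Rmult_minus_distr_r, Rabs_mult, Rmult_comm.
  apply Rmult_le_compat; try apply Rabs_pos; auto. }
apply Rabs_le. split.
- apply (is_RInt_le _ _ 0 1 _ _ Rle_0_1 (is_RInt_opp _ _ _ _ HP) HD).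
  intros x Hx. specialize (Hb x Hx). apply Rabs_le_between in Hb. apply Hb.
- apply (is_RInt_le _ _ 0 1 _ _ Rle_0_1 HD HP).
  intros x Hx. specialize (Hb x Hx). apply Rabs_le_between in Hb. apply Hb.
Qed.

Definition vanishing_continuous (Q : R -> R) : Prop :=
  Q 0 = 0 /\ forall x, 0 <= x <= 1 -> continuous Q x.

(** Weaker than continuity of [a], so as to admit [L y / y], whose default value [0] at [0] differs
    from its limit. *)
Definition multiplier (a : R -> R) : Prop :=
  forall Q, vanishing_continuous Q -> vanishing_continuous (fun y => a y * Q y).

Lemma vanishing_continuous_ex_RInt (Q : R -> R) : vanishing_continuous Q -> ex_RInt Q 0 1.
Proof.
intros [_ H]. apply (ex_RInt_continuous (V := R_CompleteNormedModule)).
intros z Hz. rewrite Rmin_left, Rmax_right in Hz by lra. apply H. exact Hz.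
Qed.

Lemma vanishing_continuous_bounded (Q : R -> R) : vanishing_continuous Q ->
  exists K, forall y, 0 < y < 1 -> Rabs (Q y) <= K.
Proof.
intros [_ H]. destruct (bounded_continuity Q 0 1 H) as [K HK].
exists K. intros y Hy. left. apply HK. lra.
Qed.

Lemma continuous_multiplier (a : R -> R) :
  (forall x, 0 <= x <= 1 -> continuous a x) -> multiplier a.
Proof.
intros Ha Q [HQ0 HQ]. split; [rewrite HQ0; ring|].
intros x Hx. apply (continuous_mult a Q); auto.
Qed.

(** Differentiability bounds the quotient by [|l| + 1] near [x0]; the factor [Q], which tends to
    [0], does the rest whatever the default value of the quotient at [x0]. *)
Lemma continuous_quotient (L Q : R -> R) (x0 l : R) : L x0 = 0 -> is_derive L x0 l ->
  continuous Q x0 -> Q x0 = 0 -> continuous (fun y => L y / (y - x0) * Q y) x0.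
Proof.
intros HL0 HL HQ HQ0. apply is_derive_Reals in HL. destruct (HL 1 Rlt_0_1) as [d Hd].
apply continuous_dominated with (fun y => (Rabs l + 1) * Rabs (Q y)).
- apply (continuous_mult (fun _ => Rabs l + 1) (fun y => Rabs (Q y)));
    [apply continuous_const|].
  apply (continuous_comp Q Rabs); [exact HQ|apply continuous_Rabs].
- rewrite HQ0, Rabs_R0. ring.
- exists d. intros y Hy. rewrite Rabs_mult.
  apply Rmult_le_compat_r; [apply Rabs_pos|].
  destruct (Req_dec y x0) as [E|E].
  + subst y. rewrite HL0. unfold Rdiv. rewrite Rmult_0_l, Rabs_R0.
    pose proof (Rabs_pos l). lra.
  + change (Rabs (y - x0) < d) in Hy.
    assert (Hh : y - x0 <> 0) by lra. specialize (Hd (y - x0) Hh Hy).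
    rewrite Rplus_minus, HL0, Rminus_0_r in Hd.
    replace (L y / (y - x0)) with (l + (L y / (y - x0) - l)) by ring.
    eapply Rle_trans; [apply Rabs_triang|]. lra.
Qed.

Lemma quotient_multiplier (L : R -> R) (l : R) : L 0 = 0 -> is_derive L 0 l ->
  (forall x, 0 < x <= 1 -> continuous L x) -> multiplier (fun y => L y / y).
Proof.
intros HL0 HL Hc Q [HQ0 HQ]. split; [rewrite HQ0; ring|].
intros x [[Hx|Hx] Hx1].
- apply (continuous_mult (fun y => L y / y) Q); [|apply HQ; lra].
  apply (continuous_mult L Rinv); [apply Hc; lra|].
  apply continuous_of_derive. auto_derive. lra.
- subst x. apply continuous_eq_locally with (fun y => L y / (y - 0) * Q y).
  + apply filter_forall. intros y. rewrite Rminus_0_r. reflexivity.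
  + apply continuous_quotient with l; auto. apply HQ. lra.
Qed.

Definition expansion (a_ : nat -> R -> R) (a : R -> R) : Prop :=
  (forall m, multiplier (a_ m)) /\ multiplier a /\
  (forall m y, 0 < y < 1 -> Rabs (a_ m y) <= 1) /\
  (forall N y, 0 < y < 1 -> Rabs (a y - sum_n (fun m => a_ m y) N) <= y ^ N).

(** The inner sum is integrated against the bounded factor [b_ n * Q]. Once it has become [a], the
    outer sum is integrated against the bounded factor [a * Q]. *)
Lemma is_iterated_series_RInt (a_ b_ : nat -> R -> R) (a b Q : R -> R) :
  expansion a_ a -> expansion b_ b -> vanishing_continuous Q ->
  (forall n, is_series (fun m => RInt (fun y => a_ m y * (b_ n y * Q y)) 0 1)
    (RInt (fun y => a y * (b_ n y * Q y)) 0 1)) /\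
  is_series (fun n => RInt (fun y => a y * (b_ n y * Q y)) 0 1)
    (RInt (fun y => a y * (b y * Q y)) 0 1).
Proof.
intros [Ha_ [Ha [Ha1 HaR]]] [Hb_ [Hb [Hb1 HbR]]] HQ. split.
- intros n. destruct (vanishing_continuous_bounded _ (Hb_ n Q HQ)) as [K HK].
  apply is_series_RInt with K; auto.
  + intros m. apply vanishing_continuous_ex_RInt, Ha_, Hb_, HQ.
  + apply vanishing_continuous_ex_RInt, Ha, Hb_, HQ.
- destruct (vanishing_continuous_bounded _ (Ha Q HQ)) as [K HK].
  assert (E : forall c : R -> R, RInt (fun y => a y * (c y * Q y)) 0 1 =
    RInt (fun y => c y * (a y * Q y)) 0 1).
  { intros c. apply RInt_ext. intros x _. real_eq. ring. }
  rewrite E.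
  apply is_series_ext with (fun n => RInt (fun y => b_ n y * (a y * Q y)) 0 1).
  { intros n. symmetry. apply E. }
  apply is_series_RInt with K; auto.
  + intros m. apply vanishing_continuous_ex_RInt, Hb_, Ha, HQ.
  + apply vanishing_continuous_ex_RInt, Hb, Ha, HQ.
Qed.

(** * Alternating expansions of [1 / (1 + y ^ p)] and of its primitive divided by [y] *)

Definition geom_term (p m : nat) (y : R) : R := (-1) ^ m * y ^ (p * m).

Definition prim_term (p m : nat) (y : R) : R := (-1) ^ m * y ^ (p * m) / INR (p * m + 1).

Lemma Rabs_geom_term (p m : nat) (y : R) : 0 < y < 1 -> Rabs (geom_term p m y) <= 1.
Proof.
intros Hy. unfold geom_term. rewrite Rabs_mult, pow_1_abs, Rmult_1_l.
rewrite Rabs_pos_eq by (apply pow_le; lra).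
rewrite <- (pow1 (p * m)). apply pow_incr. lra.
Qed.

Lemma Rabs_prim_term (p m : nat) (y : R) : 0 < y < 1 -> Rabs (prim_term p m y) <= 1.
Proof.
intros Hy. unfold prim_term. fold (geom_term p m y). unfold Rdiv. rewrite Rabs_mult.
assert (H : 1 <= INR (p * m + 1)) by (rewrite plus_INR; pose proof (pos_INR (p * m)); simpl; lra).
rewrite (Rabs_pos_eq (/ _)) by (left; apply Rinv_0_lt_compat; lra).
apply Rle_trans with (1 * / 1); [|right; field]. apply Rmult_le_compat.
- apply Rabs_pos.
- left; apply Rinv_0_lt_compat; lra.
- apply Rabs_geom_term; exact Hy.
- apply Rinv_le_contravar; lra.
Qed.

(** The remainder is exactly [(- y ^ p) ^ (N + 1) / (1 + y ^ p)]; the bound is relaxed to a form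
    independent of [p]. *)
Lemma geom_remainder (p N : nat) (y : R) : (1 <= p)%nat -> 0 <= y <= 1 ->
  Rabs (/ (1 + y ^ p) - sum_n (fun m => geom_term p m y) N) <= y ^ N.
Proof.
intros Hp Hy.
rewrite (sum_n_ext _ (fun m => (- y ^ p) ^ m)).
2:{ intros m. unfold geom_term. rewrite pow_mult, <- Rpow_mult_distr. f_equal. ring. }
fold (geom N (- y ^ p)). pose proof (geom_mult N (- y ^ p)) as HG.
assert (H0 : 0 <= y ^ p) by (apply pow_le; lra).
replace (geom N (- y ^ p)) with ((1 - (- y ^ p) ^ S N) / (1 + y ^ p))
  by (rewrite <- HG; field; lra).
replace (/ (1 + y ^ p) - (1 - (- y ^ p) ^ S N) / (1 + y ^ p))
  with ((- y ^ p) ^ S N * / (1 + y ^ p)) by (field; lra).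
rewrite Rabs_mult, <- RPow_abs, Rabs_Ropp, (Rabs_pos_eq (y ^ p)) by lra.
assert (Hi : 0 < / (1 + y ^ p) <= 1).
{ split; [apply Rinv_0_lt_compat; lra|].
  apply Rle_trans with (/ 1); [apply Rinv_le_contravar; lra|right; apply Rinv_1]. }
rewrite (Rabs_pos_eq (/ _)) by lra.
assert (H1 : y ^ p <= y).
{ destruct p as [|p]; [lia|]. simpl.
  assert (y ^ p <= 1) by (rewrite <- (pow1 p); apply pow_incr; lra).
  assert (0 <= y ^ p) by (apply pow_le; lra). nra. }
assert (H2 : (y ^ p) ^ S N <= y ^ N).
{ apply Rle_trans with (y ^ S N).
  - apply pow_incr. lra.
  - simpl. assert (0 <= y ^ N) by (apply pow_le; lra). nra. }
assert (0 <= (y ^ p) ^ S N) by (apply pow_le; lra). nra.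
Qed.

Lemma geom_expansion (p : nat) : (1 <= p)%nat ->
  expansion (geom_term p) (fun y => / (1 + y ^ p)).
Proof.
intros Hp. repeat split.
- destruct H as [HQ0 _]. rewrite HQ0. ring.
- apply (continuous_multiplier (geom_term p m)); [|exact H].
  intros x _. apply continuous_of_derive. unfold geom_term. auto_derive. trivial.
- destruct H as [HQ0 _]. rewrite HQ0. ring.
- apply (continuous_multiplier (fun y => / (1 + y ^ p))); [|exact H].
  intros x Hx. apply continuous_of_derive. auto_derive.
  pose proof (pow_le x p (proj1 Hx)). lra.
- intros m y Hy. apply Rabs_geom_term. exact Hy.
- intros N y Hy. apply geom_remainder; [exact Hp|lra].
Qed.

(** By the mean value theorem, [L y] minus its partial sum is [y] times the geometric remainder at
    some [c <= y]; dividing by [y] leaves at most [c ^ N <= y ^ N]. *)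
Lemma prim_remainder (p N : nat) (L : R -> R) (y : R) : (1 <= p)%nat -> L 0 = 0 ->
  (forall x, 0 <= x <= 1 -> is_derive L x (/ (1 + x ^ p))) -> 0 < y < 1 ->
  Rabs (L y / y - sum_n (fun m => prim_term p m y) N) <= y ^ N.
Proof.
intros Hp HL0 HL Hy.
assert (HD : forall x, 0 <= x <= 1 -> is_derive (fun x =>
    L x - sum_n (fun m => (-1) ^ m * x ^ (p * m + 1) / INR (p * m + 1)) N) x
    (/ (1 + x ^ p) - sum_n (fun m => geom_term p m x) N)).
{ intros x Hx. apply (is_derive_minus L).
  - apply HL; exact Hx.
  - apply (is_derive_sum_n (fun m x => (-1) ^ m * x ^ (p * m + 1) / INR (p * m + 1))).
    intros m _. unfold geom_term. auto_derive; [trivial|].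
    replace (Init.Nat.pred (p * m + 1)) with (p * m)%nat by lia.
    field. apply not_0_INR. lia. }
destruct (MVT_gen _ 0 y _ (fun x (Hx : Rmin 0 y < x < Rmax 0 y) =>
    HD x ltac:(rewrite Rmin_left, Rmax_right in Hx by lra; lra))) as [c [Hc He]].
{ intros x Hx. rewrite Rmin_left, Rmax_right in Hx by lra.
  apply continuity_pt_of_derive. eexists. apply HD. lra. }
rewrite Rmin_left, Rmax_right in Hc by lra.
rewrite HL0, (sum_n_ext (fun m => (-1) ^ m * 0 ^ (p * m + 1) / INR (p * m + 1)) (fun _ => 0)),
  sum_n_const in He
  by (intros m; rewrite pow_i by lia; real_eq; unfold Rdiv; ring).
rewrite (sum_n_ext _ (fun m => y * prim_term p m y)) in He
  by (intros m; unfold prim_term; rewrite pow_add; real_eq; unfold Rdiv; ring).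
replace (sum_n (fun m => y * prim_term p m y) N) with (y * sum_n (fun m => prim_term p m y) N)
  in He by (symmetry; exact (sum_n_mult_l (K := R_Ring) y (fun m => prim_term p m y) N)).
replace (L y / y - sum_n (fun m => prim_term p m y) N)
  with (/ (1 + c ^ p) - sum_n (fun m => geom_term p m c) N).
- eapply Rle_trans; [apply geom_remainder; [exact Hp|lra]|]. apply pow_incr. lra.
- set (A := / (1 + c ^ p) - sum_n (fun m => geom_term p m c) N) in *.
  set (B := sum_n (fun m => prim_term p m y) N) in *.
  replace (L y) with (y * B + A * y) by (cbv beta in He; lra). field. lra.
Qed.

Lemma prim_expansion (p : nat) (L : R -> R) : (1 <= p)%nat -> L 0 = 0 ->
  (forall x, 0 <= x <= 1 -> is_derive L x (/ (1 + x ^ p))) ->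
  expansion (prim_term p) (fun y => L y / y).
Proof.
intros Hp HL0 HL.
assert (Hm : multiplier (fun y => L y / y)).
{ apply quotient_multiplier with (/ (1 + 0 ^ p)); [exact HL0|apply HL; lra|].
  intros x Hx. apply continuous_of_derive. eexists. apply HL. lra. }
split; [|split; [|split]].
- intros m. apply continuous_multiplier. intros x _.
  apply continuous_of_derive. unfold prim_term. auto_derive. trivial.
- exact Hm.
- intros m y Hy. apply Rabs_prim_term. exact Hy.
- intros N y Hy. apply prim_remainder; assumption.
Qed.

(** * Reduction of the double series *)

Lemma vanishing_continuous_x_weight : vanishing_continuous (fun y => y * weight y).
Proof. split; [ring|]. intros x _. apply continuous_x_weight. Qed.

Lemma vanishing_continuous_id : vanishing_continuous (fun y => y).
Proof. split; [reflexivity|]. intros x _. apply continuous_id. Qed.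

Lemma RInt_monomials (Q : R -> R) (al be l : R) (i j : nat) :
  is_RInt (fun y => y ^ (i + j) * Q y) 0 1 l ->
  RInt (fun y => al * y ^ i * (be * y ^ j * Q y)) 0 1 = al * be * l.
Proof.
intros H. apply (is_RInt_unique (V := R_CompleteNormedModule)).
apply is_RInt_ext with (fun y => scal (al * be) (y ^ (i + j) * Q y)).
- intros x _. rewrite pow_add. unfold scal; simpl; unfold mult; simpl. real_eq. ring.
- apply (is_RInt_scal (V := R_NormedModule)). exact H.
Qed.

Lemma is_RInt_pow_mul_id (j : nat) :
  is_RInt (fun y => y ^ j * y) 0 1 (/ INR (j + 2)).
Proof.
replace (j + 2)%nat with (S (S j)) by lia.
apply is_RInt_ext with (fun y => y ^ S j); [|apply is_RInt_pow_unit].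
intros x _. simpl. real_eq. ring.
Qed.

(** The integral over the unit interval of the [(m, n)] term in the double expansion of
    [L y ^ 2 / y]. *)
Definition sym_term (p n m : nat) : R :=
  (-1) ^ (m + n) / (INR (p * m + 1) * INR (p * n + 1) * INR (p * m + p * n + 2)).

(* With [k = pm + pn + 2 = (pm + 1) + (pn + 1)], the [k]-th moment of the weight carries the factor
   [k / ((pm + 1)(pn + 1)) = 1 / (pm + 1) + 1 / (pn + 1)], which splits the double series into two
   products of a geometric expansion with its primitive. *)
Lemma log_series_reduction (p : nat) (L : R -> R) : (1 <= p)%nat -> L 0 = 0 ->
  (forall x, 0 <= x <= 1 -> is_derive L x (/ (1 + x ^ p))) ->
  exists (I : R) (row : nat -> R),
    is_RInt (fun y => weight y * L y / (1 + y ^ p)) 0 1 I /\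
    (forall n, is_series (fun m => sym_term p n m * ln (INR (p * m + p * n + 2))) (row n)) /\
    is_series row ((1 - euler_gamma) * RInt (fun y => L y ^ 2 / y) 0 1 - 2 * I).
Proof.
intros Hp HL0 HL.
set (g := fun y => / (1 + y ^ p)). set (h := fun y => L y / y).
set (Q := fun y => y * weight y).
pose proof (geom_expansion p Hp : expansion _ g) as Eg.
pose proof (prim_expansion p L Hp HL0 HL : expansion _ h) as Eh.
(* The [A] and [B] series expand the same integral with the two factors exchanged, one carrying
   [1 / (pm + 1)] and the other [1 / (pn + 1)]; hence [2 * I]. The [C] series, of [L y ^ 2 / y],
   accounts for the part [1 - euler_gamma] of the moments and leaves only [ln k]. *)
destruct (is_iterated_series_RInt _ _ _ _ Q Eh Eg vanishing_continuous_x_weight) as [A1 A2].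
destruct (is_iterated_series_RInt _ _ _ _ Q Eg Eh vanishing_continuous_x_weight) as [B1 B2].
destruct (is_iterated_series_RInt _ _ _ _ _ Eh Eh vanishing_continuous_id) as [C1 C2].
set (I := RInt (fun y => h y * (g y * Q y)) 0 1) in *.
assert (HI : is_RInt (fun y => weight y * L y / (1 + y ^ p)) 0 1 I).
{ apply is_RInt_ext with (fun y => h y * (g y * Q y)).
  - intros x Hx. rewrite Rmin_left, Rmax_right in Hx by lra. unfold h, g, Q. real_eq.
    assert (0 < x ^ p) by (apply pow_lt; lra). field. lra.
  - apply (RInt_correct (V := R_CompleteNormedModule)).
    apply vanishing_continuous_ex_RInt. apply Eh. apply Eg. apply vanishing_continuous_x_weight. }
replace (RInt (fun y => g y * (h y * Q y)) 0 1) with I in B2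
  by (apply RInt_ext; intros x _; real_eq; ring).
replace (RInt (fun y => h y * (h y * y)) 0 1) with (RInt (fun y => L y ^ 2 / y) 0 1) in C2.
2:{ apply RInt_ext. intros x Hx. rewrite Rmin_left, Rmax_right in Hx by lra. unfold h. real_eq.
    field. lra. }
exists I. eexists. split; [exact HI|]. split.
- intros n.
  pose proof (is_series_minus _ _ _ _ (is_series_scal (1 - euler_gamma) _ _ (C1 n))
    (is_series_plus _ _ _ _ (A1 n) (B1 n))) as HS.
  revert HS. apply is_series_ext. intros m.
  match goal with |- plus (scal ?a ?b) (opp (plus ?c ?d)) = ?e =>
    change (a * b - (c + d) = e) end.
  set (k := (p * m + p * n + 2)%nat).
  assert (EA : RInt (fun y => prim_term p m y * (geom_term p n y * Q y)) 0 1 =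
    (-1) ^ (m + n) * / INR (p * m + 1) * ((1 - euler_gamma - ln (INR k)) / INR k ^ 2)).
  { rewrite pow_add.
    transitivity ((-1) ^ m / INR (p * m + 1) * (-1) ^ n * ((1 - euler_gamma - ln (INR k)) / INR k ^ 2));
      [|real_eq; unfold Rdiv; ring].
    rewrite <- (RInt_monomials Q _ _ _ (p * m) (p * n) (is_RInt_weight_moment (p * m + p * n))).
    apply RInt_ext. intros x _. unfold prim_term, geom_term. real_eq. unfold Rdiv. ring. }
  assert (EB : RInt (fun y => geom_term p m y * (prim_term p n y * Q y)) 0 1 =
    (-1) ^ (m + n) * / INR (p * n + 1) * ((1 - euler_gamma - ln (INR k)) / INR k ^ 2)).
  { rewrite pow_add.
    transitivity ((-1) ^ m * ((-1) ^ n / INR (p * n + 1)) * ((1 - euler_gamma - ln (INR k)) / INR k ^ 2));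
      [|real_eq; unfold Rdiv; ring].
    rewrite <- (RInt_monomials Q _ _ _ (p * m) (p * n) (is_RInt_weight_moment (p * m + p * n))).
    apply RInt_ext. intros x _. unfold prim_term, geom_term. real_eq. unfold Rdiv. ring. }
  assert (EC : RInt (fun y => prim_term p m y * (prim_term p n y * y)) 0 1 =
    (-1) ^ (m + n) * / INR (p * m + 1) * / INR (p * n + 1) * / INR k).
  { rewrite pow_add.
    transitivity ((-1) ^ m / INR (p * m + 1) * ((-1) ^ n / INR (p * n + 1)) * / INR k);
      [|real_eq; unfold Rdiv; ring].
    rewrite <- (RInt_monomials (fun y => y) _ _ _ (p * m) (p * n) (is_RInt_pow_mul_id (p * m + p * n))).
    apply RInt_ext. intros x _. unfold prim_term. real_eq. unfold Rdiv. ring. }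
  change (RInt (fun y => prim_term p m y * (prim_term p n y * (fun y => y) y)) 0 1) with
    (RInt (fun y => prim_term p m y * (prim_term p n y * y)) 0 1).
  rewrite EA, EB, EC. unfold sym_term. fold k.
  assert (Hk : INR k = INR (p * m + 1) + INR (p * n + 1)) by (rewrite <- plus_INR; f_equal; unfold k; lia).
  assert (0 < INR (p * m + 1)) by (apply lt_0_INR; lia).
  assert (0 < INR (p * n + 1)) by (apply lt_0_INR; lia).
  generalize (ln (INR k)). intros l. rewrite Hk. real_eq. field. lra.
- pose proof (is_series_minus _ _ _ _ (is_series_scal (1 - euler_gamma) _ _ C2)
    (is_series_plus _ _ _ _ A2 B2)) as HS.
  evar_last; [exact HS|].
  match goal with |- plus (scal ?a ?b) (opp (plus ?c ?d)) = ?e =>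
    change (a * b - (c + d) = e) end. ring.
Qed.

(** * The integral of ln^2 (1 + y) / y *)

Lemma continuous_x_ln_sqr (x : R) : continuous (fun x => x * ln x ^ 2) x.
Proof.
apply continuous_eq_locally with (fun x => 4 * (sqrt x * ln (sqrt x)) ^ 2).
- apply filter_forall. intros y. real_eq. destruct (Rle_or_lt y 0) as [Hy|Hy].
  + rewrite ln_nonpos, sqrt_neg_0 by lra. ring.
  + pose proof (sqrt_lt_R0 y Hy) as Hs. pose proof (sqrt_sqrt y (Rlt_le _ _ Hy)) as Hss.
    set (s := sqrt y) in *. rewrite <- Hss, ln_mult by lra. ring.
- apply (continuous_comp (fun x => sqrt x * ln (sqrt x)) (fun u => 4 * u ^ 2)).
  + apply (continuous_comp sqrt (fun s => s * ln s)).
    * apply continuous_sqrt.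
    * apply continuous_x_ln_x.
  + apply continuous_of_derive. auto_derive. trivial.
Qed.

(** On the open unit interval this is [ln^2 t / (1 - t^(q+1)) - ln^2 t]: removing the first term of
    the geometric series removes the singularity at [0]. Factoring out the difference quotient of
    [ln] at [1] brings continuity there under [continuous_quotient]. *)
Definition log_sqr_tail (q : nat) (t : R) : R :=
  ln t / (t - 1) * - (ln t * t ^ S q / geom q t).

Lemma continuous_log_sqr_tail (q : nat) (t : R) : 0 <= t <= 1 ->
  continuous (log_sqr_tail q) t.
Proof.
intros Ht. pose proof (geom_ge_1 q t (proj1 Ht)) as Hg.
assert (Hig : ex_derive (fun t => / geom q t) t).
{ apply ex_derive_inv; [apply ex_derive_geom|lra]. }
destruct (Req_dec t 1) as [E|E].
- subst t. apply (continuous_quotient ln _ 1 (/ 1)).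
  + apply ln_1.
  + apply is_derive_ln. lra.
  + apply continuous_of_derive.
    apply ex_derive_ext with (fun t => (- (ln t * t ^ S q)) * / geom q t).
    { intros y. real_eq. unfold Rdiv. ring. }
    apply (ex_derive_mult (fun t => - (ln t * t ^ S q)) (fun t => / geom q t)); [|exact Hig].
    auto_derive. lra.
  + rewrite ln_1. unfold Rdiv. ring.
- apply continuous_eq_locally with (fun t => t * ln t ^ 2 * (t ^ q * / (1 - t)) * / geom q t).
  { generalize (locally_lt 1 t ltac:(lra)). apply filter_imp. intros y Hy.
    unfold log_sqr_tail, Rdiv. real_eq.
    replace (/ (y - 1)) with (- / (1 - y)) by (field; lra). simpl. ring. }
  apply (continuous_mult (fun t => t * ln t ^ 2 * (t ^ q * / (1 - t))) (fun t => / geom q t));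
    [|apply continuous_of_derive; exact Hig].
  apply (continuous_mult (fun t => t * ln t ^ 2) (fun t => t ^ q * / (1 - t)));
    [apply continuous_x_ln_sqr|].
  apply continuous_of_derive. auto_derive. lra.
Qed.

Lemma log_sqr_tail_eq (q : nat) (t : R) : 0 < t < 1 ->
  log_sqr_tail q t = ln t ^ 2 * t ^ S q / (1 - t ^ S q).
Proof.
intros Ht. unfold log_sqr_tail. rewrite <- geom_mult.
pose proof (geom_ge_1 q t). field. lra.
Qed.

Lemma is_RInt_pow_ln_sqr (i : nat) :
  is_RInt (fun t => t ^ i * (t * ln t ^ 2)) 0 1 (2 / INR (i + 2) ^ 3).
Proof.
set (c := INR (i + 2)). assert (Hc : 0 < c) by (apply lt_0_INR; lia).
(* This is [t^(i+2) (ln^2 t / c - 2 ln t / c^2 + 2 / c^3)], regrouped through [t * ln t] to be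
   continuous at [0]. *)
set (F := fun t => t ^ i * ((t * ln t) ^ 2 / c - 2 * t * (t * ln t) / c ^ 2 + 2 * t ^ 2 / c ^ 3)).
replace (2 / c ^ 3) with (F 1 - F 0).
- apply is_RInt_antiderivative; [lra|..].
  + intros x _. apply (continuous_mult (fun t => t ^ i) (fun t => t * ln t ^ 2)).
    * apply continuous_of_derive. auto_derive. trivial.
    * apply continuous_x_ln_sqr.
  + intros x _. unfold F.
    apply (continuous_mult (fun t => t ^ i)
      (fun t => (t * ln t) ^ 2 / c - 2 * t * (t * ln t) / c ^ 2 + 2 * t ^ 2 / c ^ 3)).
    { apply continuous_of_derive. auto_derive. trivial. }
    apply (continuous_plus (fun t => (t * ln t) ^ 2 / c - 2 * t * (t * ln t) / c ^ 2)
      (fun t => 2 * t ^ 2 / c ^ 3)).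
    2:{ apply continuous_of_derive. auto_derive. trivial. }
    apply (continuous_minus (fun t => (t * ln t) ^ 2 / c) (fun t => 2 * t * (t * ln t) / c ^ 2)).
    * apply (continuous_comp (fun t => t * ln t) (fun u => u ^ 2 / c)); [apply continuous_x_ln_x|].
      apply continuous_of_derive. auto_derive. trivial.
    * apply (continuous_mult (fun t => 2 * t * (t * ln t)) (fun _ => / c ^ 2));
        [|apply continuous_const].
      apply (continuous_mult (fun t => 2 * t) (fun t => t * ln t)); [|apply continuous_x_ln_x].
      apply continuous_of_derive. auto_derive. trivial.
  + intros x Hx. unfold F.
    apply is_derive_ext with (fun t => t ^ (i + 2) * (ln t ^ 2 / c - 2 * ln t / c ^ 2 + 2 / c ^ 3)).
    { intros t. real_eq. rewrite pow_add. unfold Rdiv. ring. }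
    auto_derive; [lra|].
    fold c. replace (Init.Nat.pred (i + 2)) with (S i) by lia. rewrite pow_add. simpl. field. lra.
- unfold F. rewrite pow1, ln_1. field. lra.
Qed.

(** The functions [t^((q+1)m) (1 - t^(q+1))] telescope to the constant [1], and each of them cancels
    the denominator of the tail. So termwise integration applies to an expansion of [1], with the
    tail as bounded factor. *)
Lemma is_series_log_sqr_tail (q : nat) :
  is_series (fun k => 2 / INR (S q * S k + 1) ^ 3) (RInt (log_sqr_tail q) 0 1).
Proof.
set (a_ := fun m t => t ^ (S q * m) * (1 - t ^ S q)).
assert (Hc : forall x, 0 <= x <= 1 -> continuous (log_sqr_tail q) x)
  by (intros; apply continuous_log_sqr_tail; assumption).
assert (HV : vanishing_continuous (log_sqr_tail q)).
{ split; [|exact Hc]. unfold log_sqr_tail. rewrite ln_nonpos by lra. unfold Rdiv. ring. }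
destruct (vanishing_continuous_bounded _ HV) as [K HK].
replace (RInt (log_sqr_tail q) 0 1) with (RInt (fun t => 1 * log_sqr_tail q t) 0 1)
  by (apply RInt_ext; intros x _; real_eq; ring).
apply is_series_ext with (fun m => RInt (fun t => a_ m t * log_sqr_tail q t) 0 1).
- intros m. apply (is_RInt_unique (V := R_CompleteNormedModule)).
  replace (S q * S m + 1)%nat with (S q * m + q + 2)%nat by lia.
  apply is_RInt_ext with (fun t => t ^ (S q * m + q) * (t * ln t ^ 2)).
  + intros x Hx. rewrite Rmin_left, Rmax_right in Hx by lra.
    rewrite log_sqr_tail_eq by lra. unfold a_. real_eq. rewrite pow_add.
    assert (x ^ S q < 1) by (apply pow_lt_1; lra).
    rewrite <- (tech_pow_Rmult x q) in *. field. lra.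
  + apply is_RInt_pow_ln_sqr.
- apply is_series_RInt with K.
  + intros m. apply vanishing_continuous_ex_RInt.
    apply (continuous_multiplier (a_ m)); [|exact HV].
    intros x _. apply continuous_of_derive. unfold a_. auto_derive. trivial.
  + apply vanishing_continuous_ex_RInt. apply (continuous_multiplier (fun _ => 1)); [|exact HV].
    intros x _. apply continuous_const.
  + exact HK.
  + intros N y Hy.
    assert (ES : sum_n (fun m => a_ m y) N = 1 - (y ^ S q) ^ S N).
    { rewrite <- geom_mult. unfold geom.
      rewrite (sum_n_ext _ (fun m => (1 - y ^ S q) * (y ^ S q) ^ m))
        by (intros m; unfold a_; rewrite pow_mult; real_eq; ring).
      exact (sum_n_mult_l (K := R_Ring) (1 - y ^ S q) (fun m => (y ^ S q) ^ m) N). }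
    rewrite ES. replace (1 - (1 - (y ^ S q) ^ S N)) with ((y ^ S q) ^ S N) by ring.
    assert (0 <= y ^ S q) by (apply pow_le; lra).
    rewrite Rabs_pos_eq by (apply pow_le; lra).
    assert (y ^ S q <= y).
    { simpl. assert (y ^ q <= 1) by (rewrite <- (pow1 q); apply pow_incr; lra).
      assert (0 <= y ^ q) by (apply pow_le; lra). nra. }
    apply Rle_trans with (y ^ S N); [apply pow_incr; lra|].
    simpl. assert (0 <= y ^ N) by (apply pow_le; lra). nra.
Qed.

Lemma is_series_incr_1_R (u : nat -> R) (l : R) :
  is_series (fun k => u (S k)) l -> is_series u (u 0%nat + l).
Proof.
intros H. apply is_series_decr_1.
evar_last; [exact H|]. change (l = u 0%nat + l + - u 0%nat). ring.
Qed.

(** The cases of interest are [q = 0], all cubes, and [q = 1], odd cubes. Convergence of the series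
    for [zeta 3] also comes from here. *)
Lemma is_series_log_sqr (q : nat) :
  is_series (fun k => / INR (S q * k + 1) ^ 3) (1 + RInt (log_sqr_tail q) 0 1 / 2).
Proof.
evar_last.
- apply is_series_incr_1_R.
  pose proof (is_series_scal (/ 2) _ _ (is_series_log_sqr_tail q)) as H.
  revert H. apply is_series_ext. intros k.
  change (/ 2 * (2 / INR (S q * S k + 1) ^ 3) = / INR (S q * S k + 1) ^ 3).
  field. apply not_0_INR. lia.
- cbv beta. rewrite Nat.mul_0_r. change (/ 1 ^ 3 + / 2 * RInt (log_sqr_tail q) 0 1 =
    1 + RInt (log_sqr_tail q) 0 1 / 2). field.
Qed.

Lemma is_series_zeta_3 : is_series (fun k => / INR (S k) ^ 3) (zeta 3).
Proof.
unfold zeta.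
rewrite (Series_ext _ (fun k => / INR (S k) ^ 3)).
- apply Series_correct. eexists.
  apply is_series_ext with (2 := is_series_log_sqr 0). intros k.
  do 3 f_equal. lia.
- intros k. f_equal. replace 3 with (INR 3) by (simpl; ring).
  apply Rpower_pow. apply lt_0_INR. lia.
Qed.

Lemma RInt_log_sqr_tail_0 : RInt (log_sqr_tail 0) 0 1 = 2 * zeta 3 - 2.
Proof.
assert (E : 1 + RInt (log_sqr_tail 0) 0 1 / 2 = zeta 3); [|lra].
rewrite <- (is_series_unique _ _ is_series_zeta_3).
rewrite <- (is_series_unique _ _ (is_series_log_sqr 0)).
apply Series_ext. intros k. do 3 f_equal. lia.
Qed.

(** Among the first [2N + 2] cubes the even ones make up [1 / 8] of the sum of the first [N + 1];
    this finite identity passes to the limit. *)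
Lemma is_series_odd_cubes : is_series (fun k => / INR (2 * k + 1) ^ 3) (7 / 8 * zeta 3).
Proof.
pose proof (is_series_zeta_3 : is_lim_seq _ (zeta 3)) as HZ.
assert (HS : is_lim_seq (fun N => sum_n (fun k => / INR (S k) ^ 3) (S (2 * N))) (zeta 3)).
{ apply (is_lim_seq_subseq (sum_n (fun k => / INR (S k) ^ 3)) (zeta 3) (fun N => S (2 * N)));
    [|exact HZ].
  apply eventually_subseq. intros n. lia. }
change (is_lim_seq (sum_n (fun k => / INR (2 * k + 1) ^ 3)) (7 / 8 * zeta 3)).
apply is_lim_seq_ext with (fun N => sum_n (fun k => / INR (S k) ^ 3) (S (2 * N)) -
  / 8 * sum_n (fun k => / INR (S k) ^ 3) N).
- intros N. induction N as [|N IH].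
  + rewrite !sum_O. rewrite sum_Sn, sum_O. change (/ 1 ^ 3 + / (1 + 1) ^ 3 - / 8 * / 1 ^ 3 = / 1 ^ 3).
    field.
  + replace (S (2 * S N)) with (S (S (S (2 * N)))) by lia.
    rewrite (sum_Sn _ (S (S (2 * N)))), (sum_Sn _ (S (2 * N))), !(sum_Sn _ N), <- IH.
    match goal with |- plus (plus ?A ?x) ?y - / 8 * plus ?B ?z = plus ?C ?w =>
      change (A + x + y - / 8 * (B + z) = (A - / 8 * B) + w) end.
    replace (INR (S (S (S (2 * N))))) with (INR (2 * S N + 1)) by (f_equal; lia).
    replace (INR (S (S (S (S (2 * N)))))) with (2 * INR (S (S N)))
      by (change 2 with (INR 2); rewrite <- mult_INR; f_equal; lia).
    field. split; apply not_0_INR; lia.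
- replace (7 / 8 * zeta 3) with (zeta 3 - / 8 * zeta 3) by field.
  apply (is_lim_seq_minus' _ _ _ _ HS).
  apply (is_lim_seq_scal_l _ (/ 8) (zeta 3)). exact HZ.
Qed.

Lemma RInt_log_sqr_tail_1 : RInt (log_sqr_tail 1) 0 1 = 7 / 4 * zeta 3 - 2.
Proof.
assert (E : 1 + RInt (log_sqr_tail 1) 0 1 / 2 = 7 / 8 * zeta 3); [|lra].
rewrite <- (is_series_unique _ _ is_series_odd_cubes).
symmetry. apply is_series_unique. exact (is_series_log_sqr 1).
Qed.

(** On the unit interval [Lam x] is the integral of [ln^2 t / (1 - t^(q+1))] from [x] to [1]. The
    part [ln^2 t], unbounded at [0], is integrated explicitly and contributes the [2]; the tail is
    first extended continuously to the line. *)
Lemma log_sqr_primitive (q : nat) : exists Lam : R -> R,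
  (forall x, continuous Lam x) /\ Lam 1 = 0 /\ Lam 0 = 2 + RInt (log_sqr_tail q) 0 1 /\
  forall x, 0 < x < 1 -> is_derive Lam x (- (ln x ^ 2 / (1 - x ^ S q))).
Proof.
destruct (C0_extension_le (log_sqr_tail q) 0 1
  (fun x Hx => continuous_log_sqr_tail q x Hx)) as [g [Hg Hgf]].
assert (Hex : forall a b, ex_RInt g a b).
{ intros a b. apply (ex_RInt_continuous (V := R_CompleteNormedModule)). intros z _. apply Hg. }
assert (HG : forall x, is_derive (fun x => RInt g x 1) x (- g x)).
{ intros x. apply (is_derive_RInt' g _ x 1).
  - apply filter_forall. intros y. apply (RInt_correct g y 1 (Hex y 1)).
  - apply Hg. }
exists (fun x => 2 - (x * ln x ^ 2 - 2 * (x * ln x) + 2 * x) + RInt g x 1).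
split; [|split; [|split]].
- intros x. apply (continuous_plus (fun x => 2 - (x * ln x ^ 2 - 2 * (x * ln x) + 2 * x))
    (fun x => RInt g x 1)); [|apply continuous_of_derive; eexists; apply HG].
  apply (continuous_minus (fun _ => 2) (fun x => x * ln x ^ 2 - 2 * (x * ln x) + 2 * x));
    [apply continuous_const|].
  apply (continuous_plus (fun x => x * ln x ^ 2 - 2 * (x * ln x)) (fun x => 2 * x)).
  + apply (continuous_minus (fun x => x * ln x ^ 2) (fun x => 2 * (x * ln x)));
      [apply continuous_x_ln_sqr|].
    apply (continuous_mult (fun _ => 2) (fun x => x * ln x)); [apply continuous_const|].
    apply continuous_x_ln_x.
  + apply continuous_of_derive. auto_derive. trivial.
- rewrite ln_1, RInt_point. change (2 - (1 * 0 ^ 2 - 2 * (1 * 0) + 2 * 1) + 0 = 0). ring.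
- replace (RInt g 0 1) with (RInt (log_sqr_tail q) 0 1).
  + ring.
  + apply RInt_ext. intros x Hx. rewrite Rmin_left, Rmax_right in Hx by lra.
    symmetry. apply Hgf. lra.
- intros x Hx. evar_last.
  + apply (is_derive_plus (fun x => 2 - (x * ln x ^ 2 - 2 * (x * ln x) + 2 * x))
      (fun x => RInt g x 1)); [|apply HG].
    auto_derive; [lra|]. reflexivity.
  + rewrite Hgf, log_sqr_tail_eq by lra.
    assert (x ^ S q < 1) by (apply pow_lt_1; lra).
    match goal with |- plus ?a ?b = ?c => change (a + b = c) end.
    cbn [pow] in *. field. lra.
Qed.

(* Up to a change of variables, the integrals of [ln^2 (1 - x^2)], [ln^2 ((1 - x) / (1 + x))] and
   [ln^2 (1 - x)] against [dx / x] are zeta values, and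
   [2 ln^2 (1 + x) = (a + b)^2 + (b - a)^2 - 2 a^2] with [a = ln (1 - x)], [b = ln (1 + x)]. *)
Lemma RInt_ln_1p_sqr_div : RInt (fun x => ln (1 + x) ^ 2 / x) 0 1 = zeta 3 / 4.
Proof.
destruct (log_sqr_primitive 0) as [A [HAc [HA1 [HA0 HA]]]].
destruct (log_sqr_primitive 1) as [B [HBc [HB1 [HB0 HB]]]].
rewrite RInt_log_sqr_tail_0 in HA0. rewrite RInt_log_sqr_tail_1 in HB0.
(* The derivatives of [A (1 - x^2)], [B ((1-x)/(1+x))] and [A (1-x)] are [2 (a+b)^2 / x],
   [(b-a)^2 / (2x)] and [a^2 / x], which fixes the coefficients. *)
set (F := fun x => (A (1 - x ^ 2) / 2 + 2 * B ((1 - x) / (1 + x)) - 2 * A (1 - x)) / 2).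
assert (E : F 1 - F 0 = zeta 3 / 4).
{ unfold F. replace (1 - 1 ^ 2) with 0 by ring. replace ((1 - 1) / (1 + 1)) with 0 by field.
  replace (1 - 1) with 0 by ring. replace (1 - 0 ^ 2) with 1 by ring.
  replace ((1 - 0) / (1 + 0)) with 1 by field. replace (1 - 0) with 1 by ring.
  rewrite HA0, HA1, HB0, HB1. field. }
rewrite <- E. apply (is_RInt_unique (V := R_CompleteNormedModule)).
apply is_RInt_antiderivative; [lra|..].
- assert (Hln : forall x, 0 <= x -> is_derive (fun x => ln (1 + x)) x (/ (1 + x))).
  { intros x Hx. auto_derive; [lra|]. field. lra. }
  intros x [[Hx|Hx] Hx1].
  + apply continuous_of_derive. auto_derive. split; [lra|]. split; [lra|trivial].
  + subst x. apply continuous_eq_locally with (fun x => ln (1 + x) / (x - 0) * ln (1 + x)).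
    * apply filter_forall. intros y. rewrite Rminus_0_r. unfold Rdiv. real_eq. ring.
    * apply (continuous_quotient (fun x => ln (1 + x)) (fun x => ln (1 + x)) 0 (/ (1 + 0))).
      -- rewrite Rplus_0_r. apply ln_1.
      -- apply Hln. lra.
      -- apply continuous_of_derive. eexists. apply Hln. lra.
      -- rewrite Rplus_0_r. apply ln_1.
- intros x Hx. unfold F.
  apply (continuous_mult (fun x => A (1 - x ^ 2) / 2 + 2 * B ((1 - x) / (1 + x)) - 2 * A (1 - x))
    (fun _ => / 2)); [|apply continuous_const].
  apply (continuous_minus (fun x => A (1 - x ^ 2) / 2 + 2 * B ((1 - x) / (1 + x)))
    (fun x => 2 * A (1 - x))).
  + apply (continuous_plus (fun x => A (1 - x ^ 2) / 2) (fun x => 2 * B ((1 - x) / (1 + x)))).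
    * apply (continuous_mult (fun x => A (1 - x ^ 2)) (fun _ => / 2)); [|apply continuous_const].
      apply (continuous_comp (fun x => 1 - x ^ 2) A); [|apply HAc].
      apply continuous_of_derive. auto_derive. trivial.
    * apply (continuous_mult (fun _ => 2) (fun x => B ((1 - x) / (1 + x))));
        [apply continuous_const|].
      apply (continuous_comp (fun x => (1 - x) / (1 + x)) B); [|apply HBc].
      apply continuous_of_derive. auto_derive. lra.
  + apply (continuous_mult (fun _ => 2) (fun x => A (1 - x))); [apply continuous_const|].
    apply (continuous_comp (fun x => 1 - x) A); [|apply HAc].
    apply continuous_of_derive. auto_derive. trivial.
- intros x Hx. unfold F.
  assert (H1 : 0 < 1 - x ^ 2 < 1) by nra.
  assert (H2 : 0 < (1 - x) / (1 + x) < 1).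
  { split; [apply Rdiv_lt_0_compat; lra|]. apply Rmult_lt_reg_r with (1 + x); [lra|].
    unfold Rdiv. rewrite Rmult_assoc, Rinv_l by lra. lra. }
  assert (H3 : 0 < 1 - x < 1) by lra.
  evar_last.
  + auto_derive.
    * repeat split; try lra; eexists.
      -- replace (1 + - (x * (x * 1))) with (1 - x ^ 2) by ring. apply HA. exact H1.
      -- apply HB. exact H2.
      -- apply HA. exact H3.
    * reflexivity.
  + replace (1 + - (x * (x * 1))) with (1 - x ^ 2) by ring.
    change (Derive (fun x => A x)) with (Derive A). change (Derive (fun x => B x)) with (Derive B).
    change ((1 + - x) * / (1 + x)) with ((1 - x) / (1 + x)). change (1 + - x) with (1 - x).
    rewrite (is_derive_unique _ _ _ (HA _ H1)), (is_derive_unique _ _ _ (HB _ H2)),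
      (is_derive_unique _ _ _ (HA _ H3)).
    real_eq.
    replace (ln ((1 - x) / (1 + x))) with (ln (1 - x) - ln (1 + x))
      by (unfold Rdiv; rewrite ln_mult, ln_Rinv by (try apply Rinv_0_lt_compat; lra); ring).
    replace (1 - x ^ 2) with ((1 - x) * (1 + x)) by ring. rewrite ln_mult by lra.
    field. repeat split; nra.
Qed.

(** * The integral of atan^2 y / y *)

Lemma x_cos_le_sin (u : R) : 0 <= u <= PI -> u * cos u <= sin u.
Proof.
intros [[Hu|Hu] HuP].
- destruct (MVT_gen (fun u => sin u - u * cos u) 0 u (fun u => u * sin u)) as [c [Hc He]].
  + intros x Hx. auto_derive; [trivial|]. ring.
  + intros x Hx. apply continuity_pt_of_derive. auto_derive. trivial.
  + rewrite Rmin_left, Rmax_right in Hc by lra.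
    rewrite sin_0 in He. pose proof (sin_ge_0 c ltac:(lra) ltac:(lra)).
    assert (0 <= c * sin c * (u - 0)) by (apply Rmult_le_pos; [apply Rmult_le_pos|]; lra). lra.
- subst u. rewrite sin_0. lra.
Qed.

(** From [sin x = 2 sin (x/2) cos (x/2) >= x cos^2 (x/2)], where [cos^2 (x/2) >= 1/2] because
    [cos x >= 0]. *)
Lemma half_le_sin (x : R) : 0 <= x <= PI / 2 -> x / 2 <= sin x.
Proof.
intros Hx. pose proof (x_cos_le_sin (x / 2) ltac:(lra)) as H.
replace x with (2 * (x / 2)) at 2 by field. rewrite sin_2a.
assert (Hc : 0 <= cos x) by (apply cos_ge_0; lra).
replace x with (2 * (x / 2)) in Hc by field. rewrite cos_2a in Hc.
pose proof (sin2_cos2 (x / 2)) as H2. unfold Rsqr in H2.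
assert (0 <= cos (x / 2)) by (apply cos_ge_0; lra). nra.
Qed.

(** At [0] the default value is [0], not the limit [1], so it is used through products with
    functions vanishing at [0]. Continuity at [0] being two-sided, its bound is also established for
    negative arguments. *)
Definition inv_sinc (x : R) : R := x / sin x.

Lemma Rabs_inv_sinc_le (x : R) : - (PI / 2) <= x <= PI / 2 -> Rabs (inv_sinc x) <= 2.
Proof.
assert (Hpos : forall x, 0 <= x <= PI / 2 -> Rabs (inv_sinc x) <= 2).
{ clear x. intros x Hx. unfold inv_sinc. pose proof (half_le_sin x Hx) as H.
  destruct (proj1 Hx) as [H0|H0].
  - rewrite Rabs_pos_eq.
    + apply Rmult_le_reg_r with (sin x); [lra|].
      unfold Rdiv. rewrite Rmult_assoc, Rinv_l by lra. lra.
    + apply Rlt_le, Rdiv_lt_0_compat; lra.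
  - rewrite <- H0. unfold Rdiv. rewrite Rmult_0_l, Rabs_R0. lra. }
intros Hx. destruct (Rle_or_lt 0 x) as [H|H]; [apply Hpos; lra|].
replace (inv_sinc x) with (inv_sinc (- x)); [apply Hpos; lra|].
unfold inv_sinc. rewrite sin_neg. unfold Rdiv. rewrite Rinv_opp. ring.
Qed.

Lemma sin_pos_quarter (x : R) : 0 < x <= PI / 2 -> 0 < sin x.
Proof. intros Hx. apply sin_gt_0; pose proof PI_RGT_0; lra. Qed.

Lemma continuous_inv_sinc_mult (Q : R -> R) (B : R -> R) (C x : R) :
  0 <= x <= PI / 2 ->
  (forall y, 0 < y -> y <= PI / 2 -> continuous B y) ->
  (forall y, - (PI / 2) <= y <= PI / 2 -> Rabs (B y) <= C) ->
  continuous Q x -> (x = 0 -> Q x = 0) ->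
  continuous (fun y => B y * Q y) x.
Proof.
intros Hx HB HC HQ HQ0. destruct (proj1 Hx) as [H0|H0].
- apply (continuous_mult B Q); [apply HB; lra|exact HQ].
- subst x. specialize (HQ0 eq_refl).
  apply continuous_dominated with (fun y => C * Rabs (Q y)).
  + apply (continuous_mult (fun _ => C) (fun y => Rabs (Q y))); [apply continuous_const|].
    apply (continuous_comp Q Rabs); [exact HQ|apply continuous_Rabs].
  + rewrite HQ0, Rabs_R0. ring.
  + pose proof PI_RGT_0.
    assert (Hm : - (PI / 2) < 0) by lra. assert (Hp : 0 < PI / 2) by lra.
    generalize (filter_and _ _ (locally_gt _ _ Hm) (locally_lt _ _ Hp)).
    apply filter_imp. intros y [Hy1 Hy2]. rewrite Rabs_mult.
    apply Rmult_le_compat_r; [apply Rabs_pos|]. apply HC. split; left; assumption.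
Qed.

Lemma continuous_inv_sinc (x : R) : 0 < x -> x <= PI / 2 -> continuous inv_sinc x.
Proof.
intros H0 H1. apply continuous_of_derive. unfold inv_sinc. auto_derive.
pose proof (sin_pos_quarter x). lra.
Qed.

Lemma continuous_sqr_div_sin_mult (h : R -> R) (x : R) : 0 <= x <= PI / 2 ->
  continuous h x -> continuous (fun y => inv_sinc y * (y * h y)) x.
Proof.
intros Hx Hh. apply continuous_inv_sinc_mult with 2; auto.
- intros; apply continuous_inv_sinc; lra.
- apply Rabs_inv_sinc_le.
- apply (continuous_mult (fun y => y) h); [apply continuous_id|exact Hh].
- intros ->. ring.
Qed.

(* Riemann-Lebesgue with an explicit rate, by parts: the derivative [2 r - r^2 cos] of
   [x r = x^2 / sin x], where [r = x / sin x], is bounded by [8]. *)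
Lemma RInt_sqr_div_sin_cos_bound (M : R) : 0 < M ->
  Rabs (RInt (fun x => inv_sinc x * (x * cos (M * x))) 0 (PI / 2)) <= (8 + PI) * PI / M.
Proof.
intros HM. pose proof PI_RGT_0 as HPI.
set (u := fun x => inv_sinc x * (x * cos (M * x))).
set (dh := fun x => 2 * inv_sinc x - inv_sinc x ^ 2 * cos x).
set (f := fun x => dh x * (sin (M * x) / M) + u x).
set (F := fun x => inv_sinc x * (x * (sin (M * x) / M))).
assert (Hdh : forall x, - (PI / 2) <= x <= PI / 2 -> Rabs (dh x) <= 8).
{ intros x Hx. unfold dh. pose proof (Rabs_inv_sinc_le x Hx) as Hr.
  pose proof (COS_bound x) as Hc. apply Rabs_le_between in Hr. apply Rabs_le_between. nra. }
assert (Hcu : forall x, 0 <= x <= PI / 2 -> continuous u x).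
{ intros x Hx. apply (continuous_sqr_div_sin_mult (fun x => cos (M * x))); [exact Hx|].
  apply continuous_of_derive. auto_derive. trivial. }
assert (HF : is_RInt f 0 (PI / 2) (F (PI / 2) - F 0)).
{ apply is_RInt_antiderivative; [lra|..].
  - intros x Hx. unfold f. apply (continuous_plus (fun x => dh x * (sin (M * x) / M)) u);
      [|apply Hcu; exact Hx].
    apply (continuous_inv_sinc_mult (fun x => sin (M * x) / M) dh 8); auto.
    + intros y Hy0 Hy1. unfold dh.
      apply (continuous_minus (fun x => 2 * inv_sinc x) (fun x => inv_sinc x ^ 2 * cos x)).
      * apply (continuous_mult (fun _ => 2) inv_sinc); [apply continuous_const|].
        apply continuous_inv_sinc; lra.
      * apply (continuous_mult (fun x => inv_sinc x ^ 2) cos).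
        -- apply (continuous_comp inv_sinc (fun r => r ^ 2)); [apply continuous_inv_sinc; lra|].
           apply continuous_of_derive. auto_derive. trivial.
        -- apply continuous_of_derive. auto_derive. trivial.
    + apply continuous_of_derive. auto_derive. trivial.
    + intros ->. rewrite Rmult_0_r, sin_0. unfold Rdiv. ring.
  - intros x Hx. apply (continuous_sqr_div_sin_mult (fun x => sin (M * x) / M)); [exact Hx|].
    apply continuous_of_derive. auto_derive. trivial.
  - intros x Hx. pose proof (sin_pos_quarter x ltac:(lra)) as Hs.
    unfold F, f, u, dh, inv_sinc. auto_derive; [lra|]. field. lra. }
assert (Hu : ex_RInt u 0 (PI / 2)).
{ apply (ex_RInt_continuous (V := R_CompleteNormedModule)). intros z Hz.
  rewrite Rmin_left, Rmax_right in Hz by lra. apply Hcu. exact Hz. }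
pose proof (is_RInt_minus _ _ _ _ _ _ (RInt_correct _ _ _ Hu) HF) as HD.
pose proof (is_RInt_const 0 (PI / 2) (8 / M)) as HC.
assert (Hb : forall x, 0 < x < PI / 2 -> Rabs (u x - f x) <= 8 / M).
{ intros x Hx. unfold f.
  replace (u x - (dh x * (sin (M * x) / M) + u x)) with (- (dh x * sin (M * x) * / M))
    by (unfold Rdiv; ring).
  rewrite Rabs_Ropp, !Rabs_mult, (Rabs_pos_eq (/ M)) by (left; apply Rinv_0_lt_compat; lra).
  apply Rmult_le_compat_r; [left; apply Rinv_0_lt_compat; lra|].
  replace 8 with (8 * 1) by ring. apply Rmult_le_compat; try apply Rabs_pos.
  - apply Hdh. lra.
  - apply Rabs_le. apply SIN_bound. }
assert (HP2 : 0 <= PI / 2) by lra.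
assert (HI : Rabs (RInt u 0 (PI / 2) - (F (PI / 2) - F 0)) <= PI / 2 * (8 / M)).
{ apply Rabs_le. split.
  - assert (Ho := is_RInt_le _ _ 0 (PI / 2) _ _ HP2 (is_RInt_opp _ _ _ _ HC) HD
      (fun x Hx => proj1 (proj1 (Rabs_le_between _ _) (Hb x Hx)))).
    change (- ((PI / 2 - 0) * (8 / M)) <= RInt u 0 (PI / 2) - (F (PI / 2) - F 0)) in Ho. lra.
  - assert (Ho := is_RInt_le _ _ 0 (PI / 2) _ _ HP2 HD HC
      (fun x Hx => proj2 (proj1 (Rabs_le_between _ _) (Hb x Hx)))).
    change (RInt u 0 (PI / 2) - (F (PI / 2) - F 0) <= (PI / 2 - 0) * (8 / M)) in Ho. lra. }
assert (HF0 : F 0 = 0) by (unfold F; ring).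
assert (HF1 : Rabs (F (PI / 2)) <= PI / M).
{ unfold F. pose proof (Rabs_inv_sinc_le (PI / 2) ltac:(lra)).
  replace (inv_sinc (PI / 2) * (PI / 2 * (sin (M * (PI / 2)) / M)))
    with (inv_sinc (PI / 2) * sin (M * (PI / 2)) * (PI / 2 / M)) by (unfold Rdiv; ring).
  assert (Hq : 0 < PI / 2 / M) by (apply Rdiv_lt_0_compat; lra).
  rewrite !Rabs_mult, (Rabs_pos_eq (PI / 2 / M)) by lra.
  replace (PI / M) with (2 * 1 * (PI / 2 / M)) by (field; lra).
  apply Rmult_le_compat_r; [lra|]. apply Rmult_le_compat; try apply Rabs_pos; [lra|].
  apply Rabs_le. apply SIN_bound. }
replace (RInt u 0 (PI / 2)) with ((RInt u 0 (PI / 2) - (F (PI / 2) - F 0)) + F (PI / 2))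
  by (rewrite HF0; ring).
eapply Rle_trans; [apply Rabs_triang|].
replace ((8 + PI) * PI / M) with (PI / 2 * (8 / M) + (PI / M + (3 + PI) * PI / M))
  by (field; lra).
assert (0 <= (3 + PI) * PI / M) by (apply Rlt_le, Rdiv_lt_0_compat; nra). lra.
Qed.

Lemma sin_cos_odd_multiple (k : nat) :
  sin (INR (2 * k + 1) * (PI / 2)) = (-1) ^ k /\ cos (INR (2 * k + 1) * (PI / 2)) = 0.
Proof.
induction k as [|k [IH1 IH2]].
- simpl. rewrite Rmult_1_l, sin_PI2, cos_PI2. split; reflexivity.
- replace (INR (2 * S k + 1) * (PI / 2)) with (INR (2 * k + 1) * (PI / 2) + PI).
  + rewrite neg_sin, neg_cos, IH1, IH2. simpl. split; ring.
  + replace (2 * S k + 1)%nat with (2 * k + 1 + 2)%nat by lia. rewrite (plus_INR (2 * k + 1)).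
    simpl (INR 2). field.
Qed.

Lemma is_RInt_sqr_sin (k : nat) :
  is_RInt (fun x => 2 * x ^ 2 * sin (INR (2 * k + 1) * x)) 0 (PI / 2)
    (2 * PI * ((-1) ^ k / INR (2 * k + 1) ^ 2) - 4 * / INR (2 * k + 1) ^ 3).
Proof.
destruct (sin_cos_odd_multiple k) as [Hs Hc].
assert (Hm : INR (2 * k + 1) <> 0) by (apply not_0_INR; lia).
set (m := INR (2 * k + 1)) in *. pose proof PI_RGT_0.
set (F := fun x => 2 * (- x ^ 2 * cos (m * x) / m + 2 * x * sin (m * x) / m ^ 2
  + 2 * cos (m * x) / m ^ 3)).
replace (2 * PI * ((-1) ^ k / m ^ 2) - 4 * / m ^ 3) with (F (PI / 2) - F 0).
- apply is_RInt_antiderivative; [lra|..]; intros x _.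
  + apply continuous_of_derive. auto_derive. trivial.
  + apply continuous_of_derive. unfold F. auto_derive. trivial.
  + unfold F. auto_derive; [trivial|]. field. exact Hm.
- unfold F. rewrite Hs, Hc. replace (m * 0) with 0 by ring. rewrite cos_0, sin_0. field. exact Hm.
Qed.

Lemma sum_sin_odd (N : nat) (x : R) :
  2 * sin x * sum_n (fun k => sin (INR (2 * k + 1) * x)) N = 1 - cos (INR (2 * N + 2) * x).
Proof.
assert (Hstep : forall a, 2 * sin x * sin (a + x) = cos a - cos (a + 2 * x)).
{ intros a. rewrite sin_plus, cos_plus, cos_2a, sin_2a.
  pose proof (sin2_cos2 x) as H. unfold Rsqr in H.
  replace (cos a) with (cos a * (sin x * sin x + cos x * cos x)) at 2 by (rewrite H; ring). ring. }
induction N as [|N IH].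
- rewrite sum_O. replace (INR (2 * 0 + 1) * x) with (0 + x) by (simpl; ring).
  rewrite Hstep, cos_0. replace (INR (2 * 0 + 2) * x) with (0 + 2 * x) by (simpl; ring). reflexivity.
- rewrite sum_Sn. match goal with |- _ * plus ?a ?b = _ => change (plus a b) with (a + b) end.
  rewrite Rmult_plus_distr_l, IH.
  replace (INR (2 * S N + 1) * x) with (INR (2 * N + 2) * x + x)
    by (replace (2 * S N + 1)%nat with (2 * N + 2 + 1)%nat by lia;
        rewrite (plus_INR (2 * N + 2)); simpl (INR 1); ring).
  rewrite Hstep.
  replace (INR (2 * S N + 2) * x) with (INR (2 * N + 2) * x + 2 * x)
    by (replace (2 * S N + 2)%nat with (2 * N + 2 + 2)%nat by lia;
        rewrite (plus_INR (2 * N + 2)); simpl (INR 2); ring).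
  ring.
Qed.

(** Multiplying the finite sine expansion by [x^2 / sin x] makes the error of the partial sum
    exactly the integral with [cos ((2N+2) x)]. The idle factor [1] gives both integrals the shape
    [inv_sinc x * (x * h x)]. *)
Lemma is_series_RInt_sqr_div_sin :
  is_series (fun k => 2 * PI * ((-1) ^ k / INR (2 * k + 1) ^ 2) - 4 * / INR (2 * k + 1) ^ 3)
    (RInt (fun x => inv_sinc x * (x * 1)) 0 (PI / 2)).
Proof.
pose proof PI_RGT_0.
apply is_series_of_bound with ((8 + PI) * PI / 2). intros N.
assert (Hex : forall h, (forall x, continuous h x) ->
  ex_RInt (fun x => inv_sinc x * (x * h x)) 0 (PI / 2)).
{ intros h Hh. apply (ex_RInt_continuous (V := R_CompleteNormedModule)). intros z Hz.
  rewrite Rmin_left, Rmax_right in Hz by lra. apply continuous_sqr_div_sin_mult; auto. }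
pose proof (is_RInt_sum_n _ _ 0 (PI / 2) N is_RInt_sqr_sin) as HS.
pose proof (RInt_correct _ _ _ (Hex (fun _ => 1) (fun x => continuous_const 1 x))) as H1.
pose proof (is_RInt_minus _ _ _ _ _ _ H1 HS) as HD.
match type of HD with is_RInt _ _ _ (minus ?a ?b) => change (minus a b) with (a - b) in HD;
  replace (a - b) with (RInt (fun x => inv_sinc x * (x * cos (INR (2 * N + 2) * x))) 0 (PI / 2)) end.
- eapply Rle_trans; [apply RInt_sqr_div_sin_cos_bound; apply lt_0_INR; lia|].
  right. replace (2 * N + 2)%nat with (2 * S N)%nat by lia. rewrite mult_INR. simpl (INR 2).
  field. apply not_0_INR. lia.
- rewrite <- (is_RInt_unique _ _ _ _ HD). apply RInt_ext. intros x Hx.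
  rewrite Rmin_left, Rmax_right in Hx by lra.
  match goal with |- _ = minus ?a ?b => change (minus a b) with (a - b) end. cbv beta.
  pose proof (sin_pos_quarter x ltac:(lra)) as Hs.
  replace (sum_n (fun m => 2 * x ^ 2 * sin (INR (2 * m + 1) * x)) N) with
    (2 * x ^ 2 * sum_n (fun m => sin (INR (2 * m + 1) * x)) N)
    by (symmetry; exact (sum_n_mult_l (K := R_Ring) (2 * x ^ 2) (fun m => sin (INR (2 * m + 1) * x)) N)).
  pose proof (sum_sin_odd N x) as HN.
  replace (cos (INR (2 * N + 2) * x)) with
    (1 - 2 * sin x * sum_n (fun k => sin (INR (2 * k + 1) * x)) N) by lra.
  unfold inv_sinc. real_eq. field. lra.
Qed.

(** Adding the convergent series of odd cubes isolates the Catalan series, whose convergence and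
    value follow together. *)
Lemma RInt_sqr_div_sin :
  RInt (fun x => inv_sinc x * (x * 1)) 0 (PI / 2) = 2 * PI * catalan - 7 / 2 * zeta 3.
Proof.
pose proof is_series_RInt_sqr_div_sin as HI. revert HI.
generalize (RInt (fun x => inv_sinc x * (x * 1)) 0 (PI / 2) : R). intros l HI.
pose proof PI_RGT_0.
pose proof (is_series_plus _ _ _ _ HI (is_series_scal 4 _ _ is_series_odd_cubes)) as HS.
pose proof (is_series_scal (/ (2 * PI)) _ _ HS) as HC.
assert (E : catalan = / (2 * PI) * (l + 4 * (7 / 8 * zeta 3))).
{ unfold catalan. apply is_series_unique. revert HC. apply is_series_ext. intros k.
  match goal with |- scal ?p (plus ?a (scal ?c ?d)) = ?e => change (p * (a + c * d) = e) end.
  rewrite plus_INR, mult_INR. simpl (INR 2). simpl (INR 1).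
  assert (2 * INR k + 1 <> 0) by (pose proof (pos_INR k); lra).
  change (1 + 1) with 2. field. split; lra. }
real_eq. rewrite E. field. lra.
Qed.

Lemma RInt_atan_sqr_div : RInt (fun y => atan y ^ 2 / y) 0 1 = PI / 2 * catalan - 7 / 8 * zeta 3.
Proof.
pose proof PI_RGT_0.
assert (Hc : forall y, 0 <= y -> continuous (fun y => atan y ^ 2 / y) y).
{ intros y [Hy|Hy].
  - apply continuous_of_derive. auto_derive. lra.
  - subst y. apply continuous_eq_locally with (fun x => atan x / (x - 0) * atan x).
    + apply filter_forall. intros y. rewrite Rminus_0_r. unfold Rdiv. real_eq. ring.
    + apply (continuous_quotient atan atan 0 (/ (1 + Rsqr 0))).
      * apply atan_0.
      * apply is_derive_atan.
      * apply continuous_of_derive. eexists. apply is_derive_atan.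
      * apply atan_0. }
assert (Hcos : forall x, 0 <= x <= PI / 2 -> 0 < cos (x / 2)) by (intros; apply cos_gt_0; lra).
pose proof (is_RInt_comp (fun y => atan y ^ 2 / y) (fun x => tan (x / 2))
  (fun x => / 2 * / cos (x / 2) ^ 2) 0 (PI / 2)) as HR.
rewrite Rmin_left, Rmax_right in HR by lra.
replace (tan (PI / 2 / 2)) with 1 in HR
  by (replace (PI / 2 / 2) with (PI / 4) by field; symmetry; apply tan_PI4).
replace (0 / 2) with 0 in HR by field. rewrite tan_0 in HR.
assert (HR' : is_RInt (fun x => scal (/ 2 * / cos (x / 2) ^ 2)
    (atan (tan (x / 2)) ^ 2 / tan (x / 2))) 0 (PI / 2) (RInt (fun y => atan y ^ 2 / y) 0 1)).
{ apply HR; intros x Hx; specialize (Hcos x Hx).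
  - apply Hc. unfold tan. apply Rmult_le_pos; [apply sin_ge_0; lra|].
    left. apply Rinv_0_lt_compat, Hcos.
  - unfold Rdiv in *. split.
    + unfold tan. auto_derive; [unfold Rdiv; lra|].
      pose proof (sin2_cos2 (x * / 2)) as H2. unfold Rsqr in H2.
      set (s := sin (x * / 2)) in *. set (c := cos (x * / 2)) in *.
      replace (/ 2 * / c ^ 2) with (/ 2 * ((s * s + c * c) * / c ^ 2)) by (rewrite H2; ring).
      field. lra.
    + apply continuous_of_derive. auto_derive. unfold Rdiv. simpl. nra. }
clear HR.
(* The substituted integrand is [(x/2)^2 / (2 sin (x/2) cos (x/2)) = x^2 / (4 sin x)]. *)
pose proof (is_RInt_scal _ _ _ 4 _ HR') as H4.
apply (is_RInt_ext _ (fun x => inv_sinc x * (x * 1))) in H4.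
- pose proof (is_RInt_unique _ _ _ _ H4) as E. rewrite RInt_sqr_div_sin in E.
  match type of E with _ = scal ?a ?b => change (scal a b) with (a * b) in E end.
  real_eq. lra.
- intros x Hx. rewrite Rmin_left, Rmax_right in Hx by lra.
  match goal with |- scal ?a (scal ?b ?c) = ?d => change (a * (b * c) = d) end.
  rewrite atan_tan by lra. unfold inv_sinc, tan.
  specialize (Hcos x ltac:(lra)). assert (0 < sin (x / 2)) by (apply sin_gt_0; lra).
  assert (Hsx : sin x = 2 * sin (x / 2) * cos (x / 2)) by (rewrite <- sin_2a; f_equal; field).
  rewrite Hsx. field. lra.
Qed.

(** * Conclusion *)

Lemma iterated_series_unique (t : nat -> nat -> R) (row : nat -> R) (l : R) :
  (forall n, is_series (t n) (row n)) -> is_series row l ->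
  ex_iterated_series t /\ iterated_series t = l.
Proof.
intros Ht Hrow.
assert (HE : forall n, row n = Series (t n)) by (intros n; symmetry; apply is_series_unique, Ht).
split; [split|].
- intros n. exists (row n). apply Ht.
- exists l. apply is_series_ext with (1 := HE). exact Hrow.
- unfold iterated_series. apply is_series_unique. apply is_series_ext with (1 := HE). exact Hrow.
Qed.

Theorem corollary5p11 :
  (ex_iterated_series (fun n m => log_term (S n) (S m)) /\
   is_RInt (fun y => ln (1 / y) * ln (ln (1 / y)) * ln (1 + y) / (1 + y)) 0 1
     (1 / 8 * (1 - euler_gamma) * zeta 3
      - 1 / 2 * iterated_series (fun n m => log_term (S n) (S m))))
  /\
  (ex_iterated_series atan_term /\
   is_RInt (fun y => ln (1 / y) * ln (ln (1 / y)) * atan y / (1 + y ^ 2)) 0 1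
     ((1 - euler_gamma) / 16 * (4 * PI * catalan - 7 * zeta 3)
      - 1 / 2 * iterated_series atan_term)).
Proof.
split.
- destruct (log_series_reduction 1 (fun y => ln (1 + y))) as [I [row [HI [Hrow Hsum]]]].
  + lia.
  + rewrite Rplus_0_r. apply ln_1.
  + intros x Hx. auto_derive; [lra|]. field. lra.
  + rewrite RInt_ln_1p_sqr_div in Hsum.
    assert (Ht : forall n, is_series (fun m => log_term (S n) (S m)) (row n)).
    { intros n. apply is_series_ext with (2 := Hrow n). intros m.
      unfold sym_term, log_term.
      replace (1 * m + 1)%nat with (S m) by lia. replace (1 * n + 1)%nat with (S n) by lia.
      replace (1 * m + 1 * n + 2)%nat with (S m + S n)%nat by lia.
      rewrite (Nat.add_comm (S n) (S m)).
      replace ((-1) ^ (S m + S n)) with ((-1) ^ (m + n))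
        by (rewrite !pow_add; simpl; ring).
      unfold Rdiv. real_eq. ring. }
    destruct (iterated_series_unique _ _ _ Ht Hsum) as [Hex HE].
    split; [exact Hex|]. rewrite HE.
    (* The double series equals [(1 - euler_gamma) * (zeta 3 / 4) - 2 * I]; the claim is this
       relation solved for [I]. *)
    match goal with |- is_RInt _ _ _ ?v => replace v with I by field end.
    revert HI. apply is_RInt_ext. intros x _. rewrite pow_1. reflexivity.
- destruct (log_series_reduction 2 atan) as [I [row [HI [Hrow Hsum]]]].
  + lia.
  + apply atan_0.
  + intros x Hx. evar_last; [apply is_derive_atan|]. unfold Rsqr. simpl. f_equal. ring.
  + rewrite RInt_atan_sqr_div in Hsum.
    assert (Ht : forall n, is_series (atan_term n) (row n)).
    { intros n. apply is_series_ext with (2 := Hrow n). intros m.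
      unfold sym_term, atan_term, Rdiv. real_eq. ring. }
    destruct (iterated_series_unique _ _ _ Ht Hsum) as [Hex HE].
    split; [exact Hex|]. rewrite HE.
    match goal with |- is_RInt _ _ _ ?v => replace v with I by field end.
    exact HI.
Qed.
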